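(* We have $$\sum_{n \le x} B(n) = x \log \log \sqrt{x} + F x + O \left( \frac{x}{\log x} \right),$$ where $$F:= \gamma + \sum_p \left( \log \left( 1 - \frac{1}{p} \right) + \frac{1}{p-1} \right).$$
   Context: For a positive integer $n$, $A(n)=\sum_{p^\nu \| n} \nu p$ (sum over the prime powers $p^\nu$, $\nu\ge1$, exactly dividing $n$), $A^*(n)=\sum_{p\mid n} p$ (sum over the distinct prime divisors of $n$), and $B(n)=A(n)-A^*(n)$. $\gamma$ is Euler's constant; $\sum_p$ runs over all primes. The asymptotic formula is for real $x\to\infty$. *)

(* Defs.v *)
From mathcomp Require Import all_boot all_order all_algebra.
From mathcomp Require Import all_classical all_reals all_analysis.

Set Implicit Arguments.
Unset Strict Implicit.
Unset Printing Implicit Defensive.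

Import Order.TTheory GRing.Theory Num.Theory.
Import numFieldNormedType.Exports.

Local Open Scope ring_scope.

(* [p <- primes n] lists the distinct primes dividing n, and p^(logn p n) || n. *)
Definition A (n : nat) : nat := (\sum_(p <- primes n) logn p n * p)%N.

Definition Astar (n : nat) : nat := (\sum_(p <- primes n) p)%N.

Definition B (n : nat) : int := (A n)%:Z - (Astar n)%:Z.

(* [series harmonic n] is 1 + 1/2 + ... + 1/n. *)
Definition euler_gamma (R : realType) : R :=
  limn (fun n : nat => series (@harmonic R) n - ln n%:R).

Definition F (R : realType) : R :=
  euler_gamma R +
  \big[+%R/0]_(0 <= p <oo | prime p) (ln (1 - p%:R^-1) + (p%:R - 1)^-1).

(* Makes the filter [+oo] usable in the [=O_] and [+O_] notations. *)
Canonical pinfty_filter_on (R : numFieldType) :=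
  FilterType (pinfty_nbhs R) _.

(* Main.v *)
Require Import Defs.
From mathcomp Require Import all_boot all_order all_algebra.
From mathcomp Require Import all_classical all_reals all_analysis.
From mathcomp Require Import ring lra zify.

(** Summing over n <= x first, the sum of the B(n) is the sum over primes p of
    p times the terms floor (x/p^k), k >= 2, of Legendre's formula for x!
    ([sum_B]). Only the primes p <= sqrt x matter. Replacing the integer parts
    by x/p^k and summing the geometric series turns the term of p into x/(p-1),
    with an error p (1 + log_p x); these errors add up to O(x/log x) by
    Chebyshev's bound theta n <= 4 n ([theta_le], [sum_B_approx]).

    It remains to evaluate the sum of 1/(p-1) for p <= N = floor (sqrt x). Since
    1/(p-1) = - ln (1 - 1/p) + (ln (1 - 1/p) + 1/(p-1)) and the last terms are
    those of the convergent sum in F, the theorem follows from Mertens's theorem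
    that the sum of - ln (1 - 1/p) for p <= N is ln ln N + gamma + O(1/ln N)
    ([sum_invpred]).

    That this sum is ln ln N + c + O(1/ln N) for some c ([mertens2]) is
    classical: the prime factorisation of n! gives ln n + O(1) for the sum of
    ln p/p ([sum_ln_div_prime_le], [sum_ln_div_prime_ge]), and Abel summation
    introduces the weight 1/ln p ([mertens_diff_cauchy]).

    To find c ([mertens_constant]), observe that the sum of - ln (1 - 1/p) for
    p <= e^k and the harmonic number H_k are ln k + c + o(1) and
    ln k + gamma + o(1), so that their difference tends to c - gamma. By Abel's
    theorem ([abel_limit0]), c - gamma is also the limit as s -> 0 of the
    difference of the same sums taken with the weights p^-s and exp (-s k). The
    first weighted sum is ln zeta (1+s) up to o(1), by the Euler product
    ([cvg_log_euler_prod]); the second one is - ln (1 - exp (-s)). Both are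
    - ln s + o(1), so c = gamma. *)

Set Implicit Arguments.
Unset Strict Implicit.
Unset Printing Implicit Defensive.

Import Order.TTheory GRing.Theory Num.Theory.
Import numFieldNormedType.Exports.

Local Open Scope ring_scope.

(** * Logarithms of integers *)

Section LogInequalities.
Variable R : realType.
Implicit Types x y : R.

Lemma ln_le_subr1 x : 0 < x -> ln x <= x - 1.
Proof.
move=> x0; rewrite -{1}(subrKC 1 x); apply: le_ln1Dx; lra.
Qed.

Lemma ln_ge_1subV x : 0 < x -> 1 - x^-1 <= ln x.
Proof.
move=> x0; have := @ln_le_subr1 x^-1; rewrite invr_gt0 => /(_ x0).
rewrite lnV ?posrE //; lra.
Qed.

Lemma ler_ln_gt0 x y : 0 < x -> x <= y -> ln x <= ln y.
Proof. by move=> x0 xy; rewrite ler_ln ?posrE //; apply: lt_le_trans xy. Qed.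

Lemma ln2_ge : 2^-1 <= ln 2 :> R.
Proof. by have := @ln_ge_1subV 2; lra. Qed.

Lemma ln2_le : ln 2 <= 1 :> R.
Proof. by have := @ln_le_subr1 2; lra. Qed.

Lemma ln_nat_ge0 n : 0 <= ln n%:R :> R.
Proof.
by case: n => [|n]; [rewrite ln0 | apply: ln_ge0; rewrite ler1n].
Qed.

Lemma ln_nat_ge n : (2 <= n)%N -> 2^-1 <= ln n%:R :> R.
Proof.
move=> n2; apply: le_trans ln2_ge _; apply: ler_ln_gt0; rewrite ?ltr0n//.
by rewrite (ler_nat R 2).
Qed.

Lemma ln_step_le n : (0 < n)%N -> ln n.+1%:R - ln n%:R <= n%:R^-1 :> R.
Proof.
move=> n0; have n0R : 0 < n%:R :> R by rewrite ltr0n.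
rewrite -ln_div ?posrE ?ltr0n //.
apply: le_trans (ln_le_subr1 _) _; first by rewrite divr_gt0 ?ltr0n.
by rewrite -natr1 mulrDl divff ?gt_eqF// mul1r addrAC subrr add0r.
Qed.

Lemma ln_step_ge n : (0 < n)%N -> n.+1%:R^-1 <= ln n.+1%:R - ln n%:R :> R.
Proof.
move=> n0; have n0R : 0 < n%:R :> R by rewrite ltr0n.
rewrite -ln_div ?posrE ?ltr0n //.
apply: le_trans (ln_ge_1subV _); last by rewrite divr_gt0 ?ltr0n.
rewrite invf_div -natr1 le_eqVlt; apply/orP; left; apply/eqP.
by field; rewrite natr1 pnatr_eq0.
Qed.

End LogInequalities.

(** * Sums over primes *)

Section Sums.
Variable R : realType.
Implicit Types f g : nat -> R.

(** Here g plays the part of a primitive of - f. *)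
Lemma sum_le_telescope f g m n : (m <= n)%N ->
  (forall k, (m <= k < n)%N -> f k.+1 <= g k - g k.+1) ->
  \sum_(m.+1 <= k < n.+1) f k <= g m - g n.
Proof.
move=> mn fg; rewrite big_add1 /=.
have -> : g m - g n = \sum_(m <= k < n) (g k - g k.+1).
  rewrite -[LHS]opprB -telescope_sumr// -sumrN.
  by apply: eq_bigr => k _; rewrite opprB.
by rewrite !big_nat; apply: ler_sum.
Qed.

Definition prime_sum f n : R := \sum_(0 <= p < n.+1 | prime p) f p.

Lemma prime_sumB f m n : (m <= n)%N ->
  prime_sum f n - prime_sum f m = \sum_(m.+1 <= p < n.+1 | prime p) f p.
Proof.
by move=> mn; rewrite /prime_sum (big_cat_nat _ (n := m.+1))//= addrAC subrr add0r.
Qed.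

Lemma eq_prime_sum f g n : (forall p, prime p -> (p <= n)%N -> f p = g p) ->
  prime_sum f n = prime_sum g n.
Proof.
move=> fg; rewrite /prime_sum big_nat_cond [RHS]big_nat_cond.
by apply: eq_bigr => p /andP[/= pn pp]; apply: fg.
Qed.

Lemma le_prime_sum f g n : (forall p, prime p -> (p <= n)%N -> f p <= g p) ->
  prime_sum f n <= prime_sum g n.
Proof.
move=> fg; rewrite /prime_sum big_nat_cond [leRHS]big_nat_cond.
by apply: ler_sum => p /andP[/= pn pp]; apply: fg.
Qed.

Lemma prime_sum_ge0 f n : (forall p, prime p -> 0 <= f p) -> 0 <= prime_sum f n.
Proof. by move=> f0; apply: sumr_ge0. Qed.

Lemma prime_sum_lt2 f n : (n < 2)%N -> prime_sum f n = 0.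
Proof.
move=> n2; rewrite /prime_sum big_nat_cond big1// => p /andP[/= pn pp].
by have := prime_gt1 pp; lia.
Qed.

Lemma prime_sumD f g n :
  prime_sum (fun p => f p + g p) n = prime_sum f n + prime_sum g n.
Proof. exact: big_split. Qed.

Lemma prime_sumN f n : prime_sum (fun p => - f p) n = - prime_sum f n.
Proof. exact: sumrN. Qed.

Lemma prime_sumZ c f n : prime_sum (fun p => c * f p) n = c * prime_sum f n.
Proof. by rewrite /prime_sum mulr_sumr. Qed.

Lemma prime_sum_widen f m n : (m <= n)%N ->
  (forall p, prime p -> (m < p)%N -> f p = 0) ->
  prime_sum f n = prime_sum f m.
Proof.
move=> mn f0; apply/eqP; rewrite -subr_eq0 prime_sumB//; apply/eqP.
by rewrite big_nat_cond big1// => p /andP[/andP[mp _] pp]; apply: f0.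
Qed.

(** The convergent sums over primes met below need no information on primes:
    the corresponding sums over all integers already converge. *)
Lemma prime_tail_le f g m n : (m <= n)%N ->
  (forall k, (m < k)%N -> 0 <= g k) ->
  (forall p, prime p -> (m < p)%N -> f p <= g p) ->
  \sum_(m.+1 <= p < n.+1 | prime p) f p <= \sum_(m.+1 <= k < n.+1) g k.
Proof.
move=> mn g0 fg; rewrite big_mkcond/= !big_nat; apply: ler_sum => k /andP[mk _].
by case: ifP => [/fg->//|_]; apply: g0.
Qed.

(** Telescopes, as 1/(k(k-1)) = 1/(k-1) - 1/k. *)
Lemma sum_invMpred_le m n : (0 < m)%N -> (m <= n)%N ->
  \sum_(m.+1 <= k < n.+1) (k%:R * (k%:R - 1))^-1 <= m%:R^-1 :> R.
Proof.
move=> m0 mn; apply: (@le_trans _ _ (m%:R^-1 - n%:R^-1)); last first.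
  by rewrite lerBlDr lerDl invr_ge0.
apply: (@sum_le_telescope _ (fun k => k%:R^-1)) => // k /andP[mk _].
have k0 : k%:R != 0 :> R by rewrite pnatr_eq0; lia.
rewrite -natr1 addrK le_eqVlt; apply/orP; left; apply/eqP.
have k1 : k%:R + 1 != 0 :> R by rewrite natr1 pnatr_eq0.
by field; rewrite k0 k1.
Qed.

(** Each term is at most a decrement of (ln k + 2)/k, where the 2 absorbs
    the discretisation error (k+1)(ln (k+1) - ln k) <= 2. *)
Lemma sum_ln_invMpred_le n : (0 < n)%N ->
  \sum_(2 <= k < n.+1) ln k%:R / (k%:R * (k%:R - 1)) <= 2 :> R.
Proof.
move=> n0; pose g k : R := (ln k%:R + 2) / k%:R.
apply: (@le_trans _ _ (g 1 - g n)); last first.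
  rewrite {1}/g ln1 add0r divr1 lerBlDr lerDl divr_ge0//.
  by rewrite addr_ge0// ln_nat_ge0.
apply: (@sum_le_telescope _ g) => // k /andP[k1 _].
have k0 : 0 < k%:R :> R by rewrite ltr0n.
have h : ln k.+1%:R - ln k%:R <= k%:R^-1 :> R by exact: ln_step_le.
have k1R : 1 <= k%:R :> R by rewrite ler1n.
have kE : k.+1%:R = k%:R + 1 :> R by rewrite natr1.
rewrite /g kE addrK in h *.
set a := ln k%:R in h *; set b := ln _ in h *; set x := k%:R in k0 k1R h *.
have hx : (b - a) * (x + 1) <= 2.
  apply: (@le_trans _ _ (x^-1 * (x + 1))); first by apply: ler_wpM2r => //; lra.
  by rewrite mulrDr mulVf ?gt_eqF// mulr1; have := invf_le1 k0; rewrite k1R; lra.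
rewrite -subr_ge0.
have -> : (a + 2) / x - (b + 2) / (x + 1) - b / ((x + 1) * x) =
  (2 - (b - a) * (x + 1)) / (x * (x + 1)).
  by field; rewrite !gt_eqF//; lra.
by rewrite divr_ge0//; [lra | apply: mulr_ge0; lra].
Qed.

End Sums.

(** * Chebyshev's bound *)

Section Chebyshev.
Variable R : realType.
Implicit Types n m : nat.

Lemma prime_dvd_fact p n : prime p -> (p %| n`!)%N = (p <= n)%N.
Proof.
move=> pp; elim: n => [|n IH].
  by rewrite fact0 dvdn1 leqn0; case: p pp => [|[]].
rewrite factS Euclid_dvdM// IH; apply/orP/idP => [[/dvdn_leq|]|]; [exact|lia|].
by rewrite leq_eqVlt ltnS => /orP[/eqP->|]; [left|right].
Qed.

Lemma bin_le_exp2 n m : ('C(n, m) <= 2 ^ n)%N.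
Proof.
elim: n m => [|n IH] [|m]; rewrite ?bin0 ?bin0n ?expn_gt0// binS expnS mul2n.
by rewrite -addnn leq_add.
Qed.

(** Unique factorisation, in logarithms. The cutoff N is independent of n
    because n will be a factorial N! or a binomial coefficient, whose prime
    factors are much smaller than itself. *)
Lemma ln_prime_factors n N : (0 < n)%N ->
  (forall p, prime p -> (p %| n)%N -> (p <= N)%N) ->
  ln n%:R = prime_sum (fun p => (logn p n)%:R * ln p%:R) N :> R.
Proof.
move=> n0 nN; pose M := maxn n N.
have f0 p : prime p -> ~~ (p %| n)%N -> (logn p n)%:R * ln p%:R = 0 :> R.
  by move=> pp pn; rewrite lognE pp n0 (negbTE pn) mul0r.
have <- : prime_sum (fun p => (logn p n)%:R * ln p%:R) M =
    prime_sum (fun p => (logn p n)%:R * ln p%:R) N :> R.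
  apply: prime_sum_widen; first exact: leq_maxr.
  move=> p pp Np; apply: f0 => //; apply/negP => /(nN _ pp).
  by rewrite leqNgt Np.
have -> : prime_sum (fun p => (logn p n)%:R * ln p%:R) M =
    prime_sum (fun p => (logn p n)%:R * ln p%:R) n :> R.
  apply: prime_sum_widen; first exact: leq_maxl.
  move=> p pp np; apply: f0 => //; apply/negP => /(dvdn_leq n0).
  by rewrite leqNgt np.
rewrite -{1}(partnT n0) /partn /prime_sum [RHS]big_mkcond/=.
elim: (index_iota 0 n.+1) => [|p s IH]; first by rewrite !big_nil ln1.
rewrite !big_cons natrM lnM ?posrE ?ltr0n ?prodn_gt0 ?pfactor_gt0//.
rewrite IH; congr (_ + _); case: ifP => pp; last first.
  by rewrite lognE pp expn0 ln1.
by rewrite natrX lnXn ?ltr0n ?prime_gt0// mulr_natl.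
Qed.

Definition theta : nat -> R := prime_sum (fun p => ln p%:R).

(** Every prime in (h, n], where h = ceil (n/2), divides n! but neither h!
    nor (n - h)!, hence divides the binomial coefficient C(n, h) <= 2 ^ n. *)
Lemma theta_half n : theta n - theta (uphalf n) <= n%:R.
Proof.
set h := uphalf n.
have hn : (h <= n)%N by rewrite /h; lia.
have C0 : (0 < 'C(n, h))%N by rewrite bin_gt0.
have facE : ('C(n, h) * (h`! * (n - h)`!))%N = n`! by exact: bin_fact.
have Cn p : prime p -> (p %| 'C(n, h))%N -> (p <= n)%N.
  move=> pp pC; rewrite -(prime_dvd_fact n pp).
  by rewrite -facE dvdn_mulr.
apply: (@le_trans _ _ (ln 'C(n, h)%:R)); last first.
  apply: (@le_trans _ _ (n%:R * ln 2)); last first.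
    by rewrite ler_piMr// ln2_le.
  rewrite mulr_natl -lnXn// -natrX; apply: ler_ln_gt0; rewrite ?ltr0n// ler_nat.
  exact: bin_le_exp2.
rewrite (ln_prime_factors C0 Cn) /theta prime_sumB//.
rewrite -[leRHS](subrK (prime_sum (fun p => (logn p 'C(n, h))%:R * ln p%:R) h)).
rewrite prime_sumB// ler_wpDr//.
  by apply: prime_sum_ge0 => p _; rewrite mulr_ge0// ln_nat_ge0.
rewrite big_nat_cond [leRHS]big_nat_cond.
apply: ler_sum => p /andP[/andP[hp pn] pp].
rewrite -{1}[ln p%:R]mul1r ler_wpM2r ?ln_nat_ge0// ler1n logn_gt0.
rewrite mem_primes pp C0/=.
have : (p %| n`!)%N by rewrite dvdn_fact// prime_gt0.
rewrite -facE !Euclid_dvdM// !prime_dvd_fact//.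
by rewrite (leqNgt p h) hp/= => /orP[//|]; rewrite /h in hp *; lia.
Qed.

(** Halving reduces the bound with constant c to n + c (n + 1)/2 <= c n, which
    holds for all n >= 2 as soon as c = 4. *)
Lemma theta_le n : theta n <= 4 * n%:R.
Proof.
elim/ltn_ind: n => -[|[|n]] IH.
- by rewrite /theta prime_sum_lt2// mulr0.
- by rewrite /theta prime_sum_lt2//; lra.
have h := theta_half n.+2; set m := uphalf n.+2 in h *.
have IHm : theta m <= 4 * m%:R by apply: IH; rewrite /m; lia.
have mn : m%:R * 2 <= n.+2%:R + 1 :> R.
  by rewrite -natrM natr1 ler_nat /m; lia.
have n2 : 2 <= n.+2%:R :> R by rewrite (ler_nat R 2).
lra.
Qed.

End Chebyshev.

(** * Prime exponents of factorials *)

Section LegendreFormula.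
Variable R : realType.
Implicit Types n p : nat.

Lemma natr_divn_le n d : (n %/ d)%:R <= n%:R / d%:R :> R.
Proof.
case: d => [|d]; first by rewrite divn0 invr0 mulr0.
by rewrite ler_pdivlMr ?ltr0n// -natrM ler_nat leq_divM.
Qed.

Lemma natr_divn_ge n d : (0 < d)%N -> n%:R / d%:R - 1 <= (n %/ d)%:R :> R.
Proof.
move=> d0; rewrite lerBlDr ler_pdivrMr ?ltr0n// natr1 -natrM ler_nat.
by rewrite ltnW// ltn_ceil.
Qed.

(** The terms of Legendre's formula for the exponent of p in n! that come
    from the multiples of p^2; they are all that the sum of the B(m) for
    m <= n retains. *)
Definition logn_fact2 p n := (\sum_(2 <= k < n.+1) n %/ p ^ k)%N.

Lemma logn_factE p n : prime p -> logn p n`! = (n %/ p + logn_fact2 p n)%N.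
Proof.
move=> pp; rewrite logn_fact// /logn_fact2.
case: n => [|n]; first by rewrite !big_geq// div0n.
by rewrite big_ltn// expn1.
Qed.

Lemma sum_expV p n a b : prime p -> (a <= b)%N ->
  \sum_(a.+1 <= k < b.+1) (n%:R / p%:R ^+ k) =
  n%:R / (p%:R ^+ a * (p%:R - 1)) - n%:R / (p%:R ^+ b * (p%:R - 1)) :> R.
Proof.
move=> pp ab; have p1 : 1 < p%:R :> R by rewrite ltr1n prime_gt1.
pose g k : R := n%:R / (p%:R ^+ k * (p%:R - 1)).
rewrite big_add1/= -[RHS]opprB -[X in - X]/(g b - g a) -telescope_sumr// -sumrN.
apply: eq_bigr => k _; rewrite opprB /g exprS.
have pk : p%:R ^+ k != 0 :> R by rewrite expf_neq0// gt_eqF//; lra.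
by field; rewrite pk /=; apply/andP; split; apply: lt0r_neq0; lra.
Qed.

Lemma logn_fact2_le p n : prime p ->
  (logn_fact2 p n)%:R <= n%:R / (p%:R * (p%:R - 1)) :> R.
Proof.
move=> pp; have p1 : 1 < p%:R :> R by rewrite ltr1n prime_gt1.
case: n => [|n].
  by rewrite /logn_fact2 big_geq// mul0r.
rewrite /logn_fact2 natr_sum.
apply: (@le_trans _ _ (\sum_(2 <= k < n.+2) (n.+1%:R / p%:R ^+ k))).
  by apply: ler_sum => k _; rewrite -natrX; exact: natr_divn_le.
rewrite sum_expV// expr1 lerBlDr lerDl divr_ge0//.
by rewrite mulr_ge0 ?exprn_ge0//; lra.
Qed.

(** Keep the exponents 2 <= k <= K with p ^ K <= n < p ^ (K+1): the K - 1
    integer parts lose at most 1 each, and the geometric tail after K is at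
    most 2. *)
Lemma logn_fact2_ge p n : prime p -> (0 < n)%N ->
  n%:R / (p%:R * (p%:R - 1)) - (trunc_log p n).+1%:R <=
  (logn_fact2 p n)%:R :> R.
Proof.
move=> pp n0; have p1 : 1 < p%:R :> R by rewrite ltr1n prime_gt1.
have p2 := prime_gt1 pp; set K := trunc_log p n.
have pK : (p ^ K <= n)%N by apply: trunc_logP.
have nK : (n < p ^ K.+1)%N by apply: trunc_log_ltn.
have pp1 : 0 < p%:R * (p%:R - 1) :> R by apply: mulr_gt0; lra.
have [K0|K0] := posnP K.
  apply: (@le_trans _ _ 0) => //; rewrite subr_le0 K0 ler_pdivrMr// mul1r.
  move: nK; rewrite K0 expn1 => np; have : n%:R + 1 <= p%:R :> R.
    by rewrite natr1 ler_nat.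
  have p2R : 2 <= p%:R :> R by rewrite (ler_nat R 2).
  move=> np1; apply: (@le_trans _ _ (p%:R - 1)); first lra.
  by rewrite ler_peMl//; lra.
have Kn : (K <= n)%N by apply: leq_trans pK; apply/ltnW/ltn_expl.
apply: (@le_trans _ _ (\sum_(2 <= k < K.+1) (n %/ p ^ k)%:R)); last first.
  rewrite /logn_fact2 natr_sum [leRHS](big_cat_nat _ (n := K.+1))//= ?ltnS//.
  by rewrite lerDl sumr_ge0.
apply: (@le_trans _ _ (\sum_(2 <= k < K.+1) (n%:R / p%:R ^+ k - 1))); last first.
  apply: ler_sum => k _; rewrite -natrX; apply: natr_divn_ge.
  by rewrite expn_gt0 ltnW.
rewrite sumrB sum_expV// expr1 sumr_const_nat.
have : n%:R / (p%:R ^+ K * (p%:R - 1)) <= 2 :> R.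
  have pK0 : 0 < p%:R ^+ K :> R by apply: exprn_gt0; lra.
  rewrite ler_pdivrMr; last by apply: mulr_gt0 => //; lra.
  apply: (@le_trans _ _ (p%:R ^+ K.+1)); first by rewrite -natrX ler_nat ltnW.
  rewrite exprS mulrC mulrCA; apply: ler_wpM2l; first exact: ltW.
  have : 2 <= p%:R :> R by rewrite (ler_nat R 2).
    lra.
have -> : K.+1%:R = (K.+1 - 2)%:R + 2 :> R by rewrite -natrD subnK.
lra.
Qed.

End LegendreFormula.

(** * The sum of ln p / p *)

Section Mertens1.
Variable R : realType.
Implicit Types n p : nat.

Lemma ln_fact_le n : ln n`!%:R <= n%:R * ln n%:R :> R.
Proof.
elim: n => [|n IH]; first by rewrite fact0 ln1 mul0r.
rewrite factS natrM lnM ?posrE ?ltr0n ?fact_gt0//.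
rewrite -[X in _ <= X * _]natr1 mulrDl mul1r addrC lerD2r.
apply: le_trans IH _; apply: ler_wpM2l => //.
case: n => [|n]; first by rewrite ln0// ln1.
by apply: ler_ln_gt0; rewrite ?ltr0n// ler_nat.
Qed.

Lemma ln_fact_ge n : n%:R * ln n%:R - n%:R <= ln n`!%:R :> R.
Proof.
elim: n => [|n IH]; first by rewrite fact0 ln1 mul0r subr0.
rewrite factS natrM lnM ?posrE ?ltr0n ?fact_gt0//.
have [->|n0] := posnP n; first by rewrite fact0 ln1; lra.
have h : n%:R * (ln n.+1%:R - ln n%:R) <= 1 :> R.
  by rewrite mulrC -ler_pdivlMr ?ltr0n// div1r; exact: ln_step_le.
have kE : n.+1%:R = n%:R + 1 :> R by rewrite natr1.
rewrite kE in h *; nra.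
Qed.

(** Mertens's first theorem. The prime p occurs at least n/p - 1 times in n!,
    and ln n! <= n ln n; the defects -1 add up to Chebyshev's theta n <= 4 n. *)
Lemma sum_ln_div_prime_le n : (0 < n)%N ->
  prime_sum (fun p => ln p%:R / p%:R) n <= ln n%:R + 4 :> R.
Proof.
move=> n0; have n0R : 0 < n%:R :> R by rewrite ltr0n.
rewrite -(ler_pM2l n0R) -prime_sumZ.
have /[dup] L := ln_fact_le n.
rewrite (@ln_prime_factors R n`! n) ?fact_gt0//; last first.
  by move=> p pp; rewrite prime_dvd_fact.
move=> {}L; have T := theta_le R n.
have : prime_sum (fun p => n%:R * (ln p%:R / p%:R)) n <=
  prime_sum (fun p => (logn p n`!)%:R * ln p%:R + ln p%:R) n :> R.
  apply: le_prime_sum => p pp _; rewrite -{3}[ln _]mul1r -mulrDl.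
  rewrite mulrCA mulrC ler_wpM2r ?ln_nat_ge0// -lerBlDr.
  apply: le_trans (natr_divn_ge R n (prime_gt0 pp)) _.
  by rewrite ler_nat logn_factE// leq_addr.
rewrite prime_sumD -/(theta R n); lra.
Qed.

(** Conversely p occurs at most n/p + n/(p(p-1)) times, and the excess is
    summable. *)
Lemma sum_ln_div_prime_ge n : (0 < n)%N ->
  ln n%:R - 3 <= prime_sum (fun p => ln p%:R / p%:R) n :> R.
Proof.
move=> n0; have n0R : 0 < n%:R :> R by rewrite ltr0n.
rewrite -(ler_pM2l n0R).
have L := ln_fact_ge n.
rewrite (@ln_prime_factors R n`! n) ?fact_gt0// in L; last first.
  by move=> p pp; rewrite prime_dvd_fact.
pose g k : R := ln k%:R / (k%:R * (k%:R - 1)).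
have : prime_sum (fun p => (logn p n`!)%:R * ln p%:R) n <=
  prime_sum (fun p => n%:R * (ln p%:R / p%:R) + n%:R * g p) n :> R.
  apply: le_prime_sum => p pp _.
  have p1 : 1 < p%:R :> R by rewrite ltr1n prime_gt1.
  have -> : n%:R * (ln p%:R / p%:R) + n%:R * g p =
      (n%:R / p%:R + n%:R / (p%:R * (p%:R - 1))) * ln p%:R.
    by rewrite /g; field; rewrite !gt_eqF//; lra.
  rewrite ler_wpM2r ?ln_nat_ge0// logn_factE// natrD lerD//.
    exact: natr_divn_le.
  exact: logn_fact2_le.
rewrite prime_sumD !prime_sumZ => H.
suff : prime_sum g n <= 2 by nra.
apply: le_trans (sum_ln_invMpred_le R n0).
rewrite -[leLHS]subr0 -[X in _ - X](@prime_sum_lt2 _ g 1)// prime_sumB//.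
apply: (@prime_tail_le R g g 1 n) => // k k1; rewrite divr_ge0 ?ln_nat_ge0//.
by rewrite mulr_ge0// subr_ge0 ler1n ltnW.
Qed.

End Mertens1.

(** * Convergence with a rate *)

Section CauchyRate.
Local Open Scope classical_set_scope.
Variable R : realType.
Implicit Types u e c : nat -> R.

(** A Cauchy criterion that keeps the speed of convergence: all constants
    below (Euler's, Mertens's, the sum over primes in F) are obtained with
    their error term from it. *)
Lemma cauchy_rate u e n0 : e @ \oo --> 0 ->
  (forall m n, (n0 <= m)%N -> (m <= n)%N -> `|u n - u m| <= e m) ->
  cvgn u /\ forall m, (n0 <= m)%N -> `|u m - limn u| <= e m.
Proof.
move=> e0 ue.
have cu : cvgn u.
  apply: cauchy_cvg; apply: cauchy_exP => eps eps0.
  have /cvgrPdist_lt/(_ _ eps0)[N _ Ne] := e0.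
  have := Ne _ (leq_maxl N n0); rewrite sub0r normrN => hN.
  exists (u (maxn N n0)); exists (maxn N n0) => // n /= Nn.
  rewrite -ball_normE/= distrC.
  apply: le_lt_trans (ue _ _ (leq_maxr _ _) Nn) _.
  exact: le_lt_trans (ler_norm _) hN.
split=> // m n0m.
have c1 : (fun n => `|u n - u m|) @ \oo --> `|limn u - u m|.
  by apply: cvg_norm; apply: cvgB => //; exact: cvg_cst.
rewrite distrC -(cvg_lim _ c1)//; apply: limr_le; first exact: cvgP c1.
by near=> n; apply: ue => //; near: n; exact: nbhs_infty_ge.
Unshelve. all: end_near. Qed.

(** Abel summation against a nonincreasing weight: a bounded T contributes
    no more than a multiple of the first weight. *)
Lemma abel_bound (T c : nat -> R) (C : R) m n : (m <= n)%N ->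
  (forall k, (m <= k)%N -> `|T k| <= C) ->
  (forall k, (m <= k)%N -> 0 <= c k.+1 <= c k) ->
  `|\sum_(m <= k < n) (T k.+1 - T k) * c k.+1| <= 2 * C * c m.
Proof.
move=> mn TC cd; have C0 : 0 <= C by apply: le_trans (TC m _).
have cge0 k : (m <= k)%N -> 0 <= c k.
  by move=> /cd /andP[c1 c2]; apply: le_trans c2.
(* this sharper form is stable by induction: a step adds T k (c k - c (k+1)) *)
have H : `|\sum_(m <= k < n) (T k.+1 - T k) * c k.+1 - T n * c n| <=
    C * (2 * c m - c n).
  rewrite -(subnKC mn); elim: (n - m)%N => [|d IH].
    rewrite addn0 big_geq// sub0r normrN normrM (ger0_norm (cge0 m _))//.
    by have := ler_wpM2r (cge0 m (leqnn m)) (TC m (leqnn m)); lra.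
  rewrite addnS big_nat_recr ?leq_addr//=; set k := (m + d)%N in IH *.
  have mk : (m <= k)%N by exact: leq_addr.
  set S := \sum_(_ <= _ < _) _ in IH *.
  have -> : S + (T k.+1 - T k) * c k.+1 - T k.+1 * c k.+1 =
    (S - T k * c k) + T k * (c k - c k.+1) by ring.
  apply: le_trans (ler_normD _ _) _.
  have /andP[_ ck] := cd _ mk.
  have : `|T k * (c k - c k.+1)| <= C * (c k - c k.+1).
    by rewrite normrM (ger0_norm (_ : 0 <= c k - c k.+1)) ?ler_wpM2r ?TC ?subr_ge0.
  nra.
rewrite -[X in `|X|](subrK (T n * c n)); apply: le_trans (ler_normD _ _) _.
have : `|T n * c n| <= C * c n.
  by rewrite normrM (ger0_norm (cge0 n mn)) ler_wpM2r ?cge0 ?TC.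
nra.
Qed.

End CauchyRate.

(** * Mertens's second theorem, with an unknown constant *)

Section Mertens2.
Variable R : realType.

(** For u = p ^ - s this is the logarithm of the Euler factor of p at s. *)
Definition neglog (u : R) : R := - ln (1 - u).

Lemma neglog_ge u : u < 1 -> u <= neglog u.
Proof.
by move=> u1; rewrite /neglog lerNr; have := @ln_le_subr1 _ (1 - u); lra.
Qed.

Lemma neglog_le u : u < 1 -> neglog u <= u / (1 - u).
Proof.
move=> u1; have u1' : 0 < 1 - u by lra.
rewrite /neglog lerNl; apply: le_trans (ln_ge_1subV u1').
by rewrite le_eqVlt; apply/orP; left; apply/eqP; field; rewrite gt_eqF.
Qed.

Lemma prime_natr_ge2 p : prime p -> 2 <= p%:R :> R.
Proof. by move=> /prime_gt1; rewrite (ler_nat R 2). Qed.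

Lemma neglogV_prime_bounds p : prime p ->
  0 <= neglog p%:R^-1 - p%:R^-1 <= (p%:R * (p%:R - 1))^-1.
Proof.
move=> pp; have p2 := prime_natr_ge2 pp.
have p1 : p%:R^-1 < 1 :> R by rewrite invf_lt1; lra.
rewrite subr_ge0 neglog_ge//=; apply: le_trans (lerB (neglog_le p1) (lexx _)) _.
rewrite le_eqVlt; apply/orP; left; apply/eqP; field.
by rewrite !gt_eqF//; lra.
Qed.

(** With a = ln j and b = ln (j+1), the increment ln (b/a) lies between
    1 - a/b = (b - a)/b and b/a - 1, which differ by (b - a)^2/(ab) = O(1/j^2).
*)
Lemma lnln_step j : (2 <= j)%N ->
  0 <= ln (ln j.+1%:R : R) - ln (ln j%:R) - (ln j.+1%:R - ln j%:R) / ln j.+1%:R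
    <= 8 * (j.+1%:R * (j.+1%:R - 1))^-1.
Proof.
move=> j2; have a2 : 2^-1 <= ln j%:R :> R by exact: ln_nat_ge.
have h : ln j.+1%:R - ln j%:R <= j%:R^-1 :> R by apply: ln_step_le; lia.
have h' : j.+1%:R^-1 <= ln j.+1%:R - ln j%:R :> R by apply: ln_step_ge; lia.
have j0 : 2 <= j%:R :> R by rewrite (ler_nat R 2).
have kE : j.+1%:R = j%:R + 1 :> R by rewrite natr1.
rewrite kE addrK; rewrite kE in h h'; set x := j%:R in a2 h h' j0 *.
have : 0 < (x + 1)^-1 by rewrite invr_gt0; lra.
set a := ln x in a2 h h' *; set b := ln (x + 1) in h h' * => x1.
have a0 : 0 < a by lra. have b0 : 0 < b by lra.
rewrite -ln_div ?posrE//.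
have ba0 : 0 < b / a by rewrite divr_gt0.
have H1 := ln_ge_1subV ba0; have H2 := ln_le_subr1 ba0.
rewrite invf_div in H1.
have E1 : (b - a) / b = 1 - a / b by field; rewrite gt_eqF.
rewrite E1 subr_ge0 H1 /=.
apply: (@le_trans _ _ ((b - a) ^+ 2 / (a * b))).
  have -> : (b - a) ^+ 2 / (a * b) = b / a - 1 - (1 - a / b).
    by field; rewrite !gt_eqF.
  by rewrite lerD2r.
have ab : (a * b)^-1 <= 4.
  rewrite invf_ple ?posrE ?mulr_gt0//.
  by apply: (@le_trans _ _ (2^-1 * 2^-1)); [lra|apply: ler_pM; lra].
have ba2 : (b - a) ^+ 2 <= x^-1 ^+ 2 by rewrite lerXn2r// nnegrE ?invr_ge0; lra.
apply: (@le_trans _ _ (x^-1 ^+ 2 * 4)).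
  by apply: ler_pM => //; rewrite ?invr_ge0 ?mulr_ge0 ?exprn_ge0 ?ltW//; lra.
rewrite -subr_ge0.
have -> : 8 * ((x + 1) * x)^-1 - x^-1 ^+ 2 * 4 = 4 * (x - 1) / ((x + 1) * x ^+ 2).
  by field; rewrite !gt_eqF//; lra.
by apply: divr_ge0; [|apply: mulr_ge0; rewrite ?exprn_ge0]; lra.
Qed.

Lemma prime_sumS (f : nat -> R) n :
  prime_sum f n.+1 - prime_sum f n = if prime n.+1 then f n.+1 else 0.
Proof. by rewrite prime_sumB// big_mkcond big_nat1. Qed.

Lemma invn_le_invln m : (2 <= m)%N -> m%:R^-1 <= (ln m%:R)^-1 :> R.
Proof.
move=> m2; have := ln_nat_ge R m2 => l0.
have m0 : 0 < m%:R :> R by rewrite ltr0n; lia.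
by rewrite lef_pV2 ?posrE//; [have := ln_le_subr1 m0|]; lra.
Qed.

Definition mertens_diff n : R :=
  prime_sum (fun p => neglog p%:R^-1) n - ln (ln n%:R).

(** With the weight 1/ln k, the terms 1/p are the Abel terms of
    S = sum of ln p/p, while the increments of ln ln k are, up to a convergent
    sum, the Abel terms of ln k. As T = S - ln is bounded by 4, Abel summation
    leaves O(1/ln m). *)
Lemma mertens_diff_cauchy m n : (2 <= m)%N -> (m <= n)%N ->
  `|mertens_diff n - mertens_diff m| <= 17 / ln m%:R.
Proof.
move=> m2 mn.
pose S := prime_sum (fun p => ln p%:R / p%:R : R).
pose T k := S k - ln k%:R.
pose c k : R := (ln k%:R)^-1.
pose d k : R := ln (ln k.+1%:R) - ln (ln k%:R) -
  (ln k.+1%:R - ln k%:R) / ln k.+1%:R.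
have lnp k : (m <= k)%N -> 0 < ln k%:R :> R.
  by move=> mk; have := @ln_nat_ge R k (leq_trans m2 mk); lra.
have decomp : mertens_diff n - mertens_diff m =
    \sum_(m.+1 <= p < n.+1 | prime p) (neglog p%:R^-1 - p%:R^-1) +
    \sum_(m <= k < n) (T k.+1 - T k) * c k.+1 - \sum_(m <= k < n) d k.
  have -> : mertens_diff n - mertens_diff m =
    (prime_sum (fun p => neglog p%:R^-1) n - prime_sum (fun p => neglog p%:R^-1) m)
     - (ln (ln n%:R) - ln (ln m%:R)) by rewrite /mertens_diff; ring.
  rewrite prime_sumB// -(telescope_sumr (fun k => ln (ln k%:R)))//.
  rewrite [X in _ = X + _ - _]sumrB.
  set Q := \sum_(_ <= p < _ | prime p) p%:R^-1.
  suff -> : Q = \sum_(m <= k < n) (T k.+1 - T k) * c k.+1 - \sum_(m <= k < n) d k +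
      \sum_(m <= k < n) (ln (ln k.+1%:R) - ln (ln k%:R)) by ring.
  rewrite -sumrB -big_split/= /Q big_mkcond/= big_add1/=.
  rewrite !big_nat; apply: eq_bigr => k /andP[mk _].
  have k0 : ln k.+1%:R != 0 :> R by rewrite gt_eqF// lnp// (leq_trans mk).
  have E : T k.+1 - T k = (if prime k.+1 then ln k.+1%:R / k.+1%:R else 0)
      - (ln k.+1%:R - ln k%:R).
    have := prime_sumS (fun p => ln p%:R / p%:R) k.
    by rewrite /T /S => <-; ring.
  rewrite E /c /d; by case: ifP => _; field; rewrite k0// nat1r pnatr_eq0.
rewrite decomp.
have m0 : (0 < m)%N by lia.
have B1 : `|\sum_(m.+1 <= p < n.+1 | prime p) (neglog p%:R^-1 - p%:R^-1)| <= c m.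
  rewrite ger0_norm; last by apply: sumr_ge0 => p /neglogV_prime_bounds/andP[].
  apply: le_trans (invn_le_invln m2).
  apply: le_trans (sum_invMpred_le R m0 mn).
  apply: prime_tail_le => //.
    move=> k mk; rewrite invr_ge0 mulr_ge0// subr_ge0 ler1n; lia.
  by move=> p /neglogV_prime_bounds/andP[].
have B2 : `|\sum_(m <= k < n) (T k.+1 - T k) * c k.+1| <= 2 * 4 * c m.
  apply: abel_bound => // k mk.
    rewrite ler_norml /T; have k0 : (0 < k)%N by lia.
    have := sum_ln_div_prime_le R k0; have := sum_ln_div_prime_ge R k0.
    by rewrite -/S; lra.
  rewrite invr_ge0 ln_nat_ge0/= lef_pV2 ?posrE ?lnp//; last by rewrite leqW.
  by apply: ler_ln_gt0; rewrite ?ltr0n ?ler_nat//; lia.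
have B3 : `|\sum_(m <= k < n) d k| <= 8 * c m.
  have dk k : (m <= k)%N -> 0 <= d k <= 8 * (k.+1%:R * (k.+1%:R - 1))^-1.
    by move=> mk; apply: lnln_step; apply: leq_trans mk.
  rewrite ger0_norm; last first.
    by rewrite big_nat sumr_ge0// => k /andP[/dk/andP[]].
  apply: (@le_trans _ _ (8 * m%:R^-1)); last first.
    by rewrite ler_wpM2l// invn_le_invln.
  apply: (@le_trans _ _ (8 * \sum_(m.+1 <= k < n.+1) (k%:R * (k%:R - 1))^-1)).
    rewrite mulr_sumr big_add1/= !big_nat; apply: ler_sum => k /andP[mk _].
    by have /andP[] := dk k mk.
  by rewrite ler_wpM2l// sum_invMpred_le.
apply: le_trans (ler_normB _ _) _.
have := ler_normD (\sum_(m.+1 <= p < n.+1 | prime p) (neglog p%:R^-1 - p%:R^-1))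
  (\sum_(m <= k < n) (T k.+1 - T k) * c k.+1).
move: B1 B2 B3; rewrite /c; lra.
Qed.

End Mertens2.

(** * Limits of the prime and harmonic sums *)

Section Limits.
Local Open Scope classical_set_scope.
Variable R : realType.

Lemma ln_nat_near (A : R) : \forall n \near \oo, A < ln n%:R.
Proof.
exists (Num.truncn (expR A)).+1 => // n /= An.
rewrite -[A]expRK ltr_ln ?posrE ?expR_gt0//; last by rewrite ltr0n; lia.
by apply: lt_le_trans (truncnS_gt _) _; rewrite ler_nat.
Qed.

Lemma cvg_div_ln (C : R) : C / ln n%:R @[n --> \oo] --> (0 : R).
Proof.
apply/cvgrPdist_lt => eps eps0.
near=> n.
have l0 : 0 < ln n%:R :> R by near: n; exact: ln_nat_near.
have l1 : `|C| / eps < ln n%:R by near: n; exact: ln_nat_near.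
rewrite sub0r normrN normrM normfV (gtr0_norm l0) ltr_pdivrMr//.
by rewrite ltr_pdivrMr// mulrC in l1.
Unshelve. all: end_near. Qed.

Lemma cvg_invn : n%:R^-1 @[n --> \oo] --> (0 : R).
Proof. by rewrite -cvg_shiftS/=; exact: cvg_harmonic. Qed.

Lemma mertens2 : cvgn (mertens_diff R) /\ forall m, (2 <= m)%N ->
  `|mertens_diff R m - limn (mertens_diff R)| <= 17 / ln m%:R.
Proof.
apply: (@cauchy_rate R _ (fun m => 17 / ln m%:R)); first exact: cvg_div_ln.
exact: mertens_diff_cauchy.
Qed.

(** From k to k + 1, H_k - ln k decreases by at most 1/k - 1/(k+1). *)
Lemma euler_gamma_rate :
  (fun n => series harmonic n - ln n%:R) @ \oo --> euler_gamma R /\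
  forall m, (1 <= m)%N ->
  `|series harmonic m - ln m%:R - euler_gamma R| <= m%:R^-1.
Proof.
apply: (@cauchy_rate R (fun n => series harmonic n - ln n%:R)
  (fun m => m%:R^-1)); first exact: cvg_invn.
move=> m n m0 mn; pose u n : R := series harmonic n - ln n%:R.
rewrite -/(u n) -/(u m) distrC ler_norml.
pose v k : R := k%:R^-1.
have uS k : (0 < k)%N -> 0 <= u k - u k.+1 <= v k - v k.+1.
  move=> k0; have -> : u k - u k.+1 = ln k.+1%:R - ln k%:R - k.+1%:R^-1.
    by rewrite /u seriesSr/=; ring.
  by rewrite /v subr_ge0 ln_step_ge//= lerB// ln_step_le.
have E : u m - u n = \sum_(m <= k < n) (u k - u k.+1).
  rewrite -[LHS]opprB -telescope_sumr// -sumrN.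
  by apply: eq_bigr => k _; rewrite opprB.
have p0 : 0 <= u m - u n.
  rewrite E big_nat sumr_ge0// => k /andP[mk _].
  by have /andP[] := uS k (leq_trans m0 mk).
have : u m - u n <= v m - v n.
  have -> : v m - v n = \sum_(m <= k < n) (v k - v k.+1).
    rewrite -[LHS]opprB -telescope_sumr// -sumrN.
    by apply: eq_bigr => k _; rewrite opprB.
  rewrite E !big_nat; apply: ler_sum => k /andP[mk _].
  by have /andP[] := uS k (leq_trans m0 mk).
have : 0 <= v n by rewrite invr_ge0.
have : 0 <= v m by rewrite invr_ge0.
rewrite -/(v m); lra.
Qed.

End Limits.

(** * The zeta function near 1 *)

Section Zeta.
Local Open Scope classical_set_scope.
Variables (R : realType) (s : R).
Hypothesis s0 : 0 < s.

(** n ^ - s; at n = 0 the convention ln 0 = 0 gives 1. *)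
Definition npow (n : nat) : R := expR (- s * ln n%:R).
(** n ^ - (1 + s), the general term of zeta (1 + s); it vanishes at n = 0. *)
Definition zterm (n : nat) : R := n%:R^-1 * npow n.
Definition zeta_sum (N : nat) : R := \sum_(1 <= n < N.+1) zterm n.

Lemma npow_gt0 n : 0 < npow n. Proof. exact: expR_gt0. Qed.

Lemma npow_le1 n : npow n <= 1.
Proof. by rewrite -expR0 ler_expR mulNr oppr_le0 mulr_ge0 ?ln_nat_ge0// ltW. Qed.

Lemma zterm_ge0 n : 0 <= zterm n.
Proof. by rewrite mulr_ge0// ltW// npow_gt0. Qed.

Lemma ztermM m n : (0 < m)%N -> (0 < n)%N -> zterm (m * n) = zterm m * zterm n.
Proof.
move=> m0 n0; rewrite /zterm /npow natrM lnM ?posrE ?ltr0n// mulrDr expRD invfM.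
by rewrite mulrACA.
Qed.

Lemma zterm1 : zterm 1 = 1.
Proof. by rewrite /zterm /npow ln1 mulr0 expR0 invr1 mulr1. Qed.

Lemma zterm_prime_le p : prime p -> zterm p <= p%:R^-1.
Proof. by move=> pp; rewrite ler_piMr ?invr_ge0// npow_le1. Qed.

Lemma zterm_prime_lt1 p : prime p -> zterm p < 1.
Proof.
move=> pp; apply: le_lt_trans (zterm_prime_le pp) _.
by have p2 := prime_natr_ge2 R pp; rewrite invf_lt1; lra.
Qed.

(** Together with the next lemma, a discrete form of the comparison of
    zeta (1 + s) with the integral of x ^ - (1 + s): both are the convexity
    inequality 1 + y <= exp y, at y = - s (ln (n+1) - ln n) and its opposite. *)
Lemma npow_step_le n : (0 < n)%N -> npow n - npow n.+1 <= s * zterm n.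
Proof.
move=> n0; rewrite /zterm mulrA.
have -> : npow n.+1 = expR (- (s * (ln n.+1%:R - ln n%:R))) * npow n.
  by rewrite -expRD; congr expR; ring.
rewrite -[X in X - _]mul1r -mulrBl; apply: ler_wpM2r; first exact/ltW/npow_gt0.
have : s * (ln n.+1%:R - ln n%:R) <= s / n%:R.
  by rewrite ler_wpM2l ?ln_step_le ?ltW.
by apply: le_trans; rewrite lerBlDr -lerBlDl expR_ge1Dx.
Qed.

Lemma npow_step_ge n : (0 < n)%N -> s * zterm n.+1 <= npow n - npow n.+1.
Proof.
move=> n0; rewrite /zterm mulrA.
have -> : npow n = expR (s * (ln n.+1%:R - ln n%:R)) * npow n.+1.
  by rewrite -expRD; congr expR; ring.
rewrite -[X in _ - X]mul1r -mulrBl; apply: ler_wpM2r; first exact/ltW/npow_gt0.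
have : s / n.+1%:R <= s * (ln n.+1%:R - ln n%:R).
  by rewrite ler_wpM2l ?ln_step_ge ?ltW.
by move=> /le_trans; apply; rewrite lerBrDl expR_ge1Dx.
Qed.

Lemma zeta_sum_ge N : 1 - npow N.+1 <= s * zeta_sum N.
Proof.
have -> : 1 = npow 1 by rewrite /npow ln1 mulr0 expR0.
rewrite -[leLHS]opprB -telescope_sumr// -sumrN mulr_sumr !big_nat.
by apply: ler_sum => k /andP[k0 _]; rewrite opprB npow_step_le.
Qed.

Lemma zeta_sum_le N : s * zeta_sum N <= 1 + s.
Proof.
case: N => [|N].
  by rewrite /zeta_sum big_geq// mulr0 addr_ge0// ltW.
rewrite /zeta_sum big_ltn// zterm1 mulrDr mulr1 addrC lerD2r.
apply: (@le_trans _ _ (npow 1 - npow N.+1)).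
  rewrite mulr_sumr; apply: sum_le_telescope => // k /andP[k0 _].
  exact: npow_step_ge.
by rewrite lerBlDr (le_trans (npow_le1 1))// lerDl ltW// npow_gt0.
Qed.

(** zeta (1 + s). *)
Definition zeta1 : R := limn zeta_sum.

Lemma nd_zeta_sum : nondecreasing_seq zeta_sum.
Proof.
apply/nondecreasing_seqP => n.
by rewrite /zeta_sum [leRHS]big_nat_recr//= lerDl zterm_ge0.
Qed.

Lemma cvg_zeta_sum : zeta_sum @ \oo --> zeta1.
Proof.
apply: nondecreasing_is_cvgn; first exact: nd_zeta_sum.
exists ((1 + s) / s) => _ [N _ <-].
by rewrite ler_pdivlMr// mulrC zeta_sum_le.
Qed.

Lemma zeta1_le : s * zeta1 <= 1 + s.
Proof.
rewrite mulrC -ler_pdivlMr//; apply: limr_le; first exact: cvgP cvg_zeta_sum.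
by apply: nearW => N; rewrite ler_pdivlMr// mulrC zeta_sum_le.
Qed.

Lemma npow_cvg0 : npow @ \oo --> 0.
Proof.
apply/cvgrPdist_lt => eps eps0; near=> n.
rewrite sub0r normrN gtr0_norm ?npow_gt0//.
rewrite -[eps]lnK ?posrE// ltr_expR mulNr ltrNl.
rewrite mulrC -ltr_pdivrMr//; near: n; exact: ln_nat_near.
Unshelve. all: end_near. Qed.

Lemma zeta1_ge : 1 <= s * zeta1.
Proof.
have c1 : (fun N => s * zeta_sum N + npow N.+1) @ \oo --> s * zeta1 + 0.
  apply: cvgD; first by apply: cvgMr => //; exact: cvg_zeta_sum.
  by rewrite (cvg_shiftS npow); exact: npow_cvg0.
rewrite -[leRHS]addr0 -(cvg_lim _ c1)//; apply: limr_ge; first exact: cvgP c1.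
by apply: nearW => N; have := zeta_sum_ge N; lra.
Qed.

End Zeta.

(** * The Euler product *)

Section EulerProduct.
Local Open Scope classical_set_scope.
Variables (R : realType) (s : R).
Hypothesis s0 : 0 < s.
Implicit Types n m p x N : nat.

Local Notation z := (zterm s).

(** Coprimality with N! means having no prime factor <= N, so that this is a
    sieve of Eratosthenes weighted by n ^ - (1 + s). *)
Definition sieve_sum N x : R := \sum_(1 <= n < x.+1 | coprime n N`!) z n.

Lemma coprime_prime_factor n m :
  (forall p, prime p -> (p %| n)%N -> (p %| m)%N -> False) -> coprime n m.
Proof.
move=> H; rewrite /coprime; apply/negPn/negP => g1.
have [g0|g0] := posnP (gcdn n m).
  have : ~~ (0 < gcdn n m)%N by rewrite g0.
  rewrite gcdn_gt0 negb_or -!eqn0Ngt => /andP[/eqP n0 /eqP m0].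
  by apply: (H 2); rewrite ?n0 ?m0.
apply: (H (pdiv (gcdn n m))); first by apply: pdiv_prime; lia.
  exact: dvdn_trans (pdiv_dvd _) (dvdn_gcdl _ _).
exact: dvdn_trans (pdiv_dvd _) (dvdn_gcdr _ _).
Qed.

Lemma coprime_factS_composite n N : ~~ prime N.+1 ->
  coprime n N.+1`! = coprime n N`!.
Proof.
move=> NP; rewrite factS coprimeMr andb_idl// => cn.
apply: coprime_prime_factor => p pp pn pN.
have pN' : (p <= N)%N.
  have := dvdn_leq (ltn0Sn N) pN; rewrite leq_eqVlt => /orP[/eqP pE|//].
  by rewrite -pE pp in NP.
have : (p %| gcdn n N`!)%N by rewrite dvdn_gcd pn prime_dvd_fact.
by rewrite (eqP cn) dvdn1; case: p pp {pn pN pN'} => [|[]].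
Qed.

Lemma sum_multiples (Q : pred nat) (f : nat -> R) p x : (0 < p)%N ->
  \sum_(1 <= n < x.+1 | (p %| n)%N && Q n) f n =
  \sum_(1 <= m < (x %/ p).+1 | Q (p * m)%N) f (p * m)%N.
Proof.
move=> p0; elim: x => [|x IH]; first by rewrite div0n !big_geq.
rewrite big_mkcond big_nat_recr//= -big_mkcond/= IH divnS//.
have [px|px] /= := boolP (p %| x.+1)%N; last by rewrite add0n addr0.
rewrite add1n [RHS]big_mkcond [RHS]big_nat_recr//= -big_mkcond/=.
have -> // : (p * (x %/ p).+1 = x.+1)%N.
by move/eqP: (divnK px); rewrite divnS// px add1n mulnC => /eqP.
Qed.

(** The multiples of the new prime p removed from the sieve are p m, for m in
    the previous sieve up to x/p. In the limit, this multiplies the sum by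
    1 - p ^ - (1 + s). *)
Lemma sieve_sumS_prime N x : prime N.+1 ->
  sieve_sum N.+1 x = sieve_sum N x - z N.+1 * sieve_sum N (x %/ N.+1).
Proof.
move=> NP; rewrite /sieve_sum; apply/eqP; rewrite eq_sym subr_eq; apply/eqP.
rewrite (bigID (fun n => (N.+1 %| n)%N))/= addrC; congr (_ + _).
  apply: eq_bigl => n; rewrite factS coprimeMr andbC; congr (_ && _).
  by rewrite coprime_sym prime_coprime.
under eq_bigl do rewrite andbC.
rewrite sum_multiples// mulr_sumr.
have cN : coprime N.+1 N`! by rewrite prime_coprime// prime_dvd_fact// ltnn.
rewrite big_nat_cond [RHS]big_nat_cond; apply: eq_big => m.
  by rewrite coprimeMl cN.
by move=> /andP[/andP[m0 _] _]; rewrite ztermM.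
Qed.

Lemma cvg_divn p : (0 < p)%N -> (fun x => x %/ p)%N @ \oo --> \oo.
Proof.
move=> p0; apply/cvgnyPge => A; exists (A * p)%N => // n /= An.
by rewrite leq_divRL.
Qed.

Definition log_euler_prod N : R := prime_sum (fun p => neglog (z p)) N.

Lemma cvg_sieve_sum N :
  sieve_sum N @ \oo --> zeta1 s * expR (- log_euler_prod N).
Proof.
elim: N => [|N IH].
  rewrite /log_euler_prod prime_sum_lt2// oppr0 expR0 mulr1.
  have -> : sieve_sum 0 = zeta_sum s; last exact: cvg_zeta_sum.
  by apply/funext => x; apply: eq_bigl => n; rewrite fact0 coprimen1.
have lE : log_euler_prod N.+1 =
    log_euler_prod N + if prime N.+1 then neglog (z N.+1) else 0.
  by rewrite -(prime_sumS (fun p => neglog (z p))) addrC subrK.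
have [NP|NP] := boolP (prime N.+1); rewrite lE ?NP ?(negbTE NP); last first.
  rewrite addr0; have -> // : sieve_sum N.+1 = sieve_sum N.
  by apply/funext => x; apply: eq_bigl => n; rewrite coprime_factS_composite.
have -> : sieve_sum N.+1 =
    (fun x => sieve_sum N x - z N.+1 * sieve_sum N (x %/ N.+1)).
  by apply/funext => x; exact: sieve_sumS_prime.
rewrite opprD expRD /neglog opprK lnK ?posrE; last first.
  by rewrite subr_gt0 zterm_prime_lt1.
set L := zeta1 s * _ in IH *.
have -> : zeta1 s * (expR (- log_euler_prod N) * (1 - z N.+1)) = L - z N.+1 * L.
  by rewrite /L; ring.
apply: cvgB => //; apply: cvgMr.
exact: (cvg_comp _ _ (cvg_divn (ltn0Sn N)) IH).
Qed.

Lemma sieve_sum_ge N x : (0 < x)%N -> 1 <= sieve_sum N x.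
Proof.
move=> x0; rewrite /sieve_sum big_ltn_cond//= coprime1n zterm1 lerDl.
by apply: sumr_ge0 => n _; exact: zterm_ge0.
Qed.

Lemma sieve_sum_le N x : (0 < N)%N -> (N <= x)%N ->
  sieve_sum N x <= 1 + (zeta_sum s x - zeta_sum s N).
Proof.
move=> N0 Nx.
have -> : zeta_sum s x - zeta_sum s N = \sum_(N.+1 <= n < x.+1) z n.
  by rewrite /zeta_sum (big_cat_nat _ (n := N.+1))//= addrAC subrr add0r.
rewrite /sieve_sum big_mkcond/= (big_cat_nat _ (n := N.+1))//= lerD//; last first.
  by apply: ler_sum => n _; case: ifP => // _; exact: zterm_ge0.
rewrite big_ltn// coprime1n zterm1 big_nat big1 ?addr0// => n /andP[n2 nN].
case: ifP => // cn; have pp := pdiv_prime n2.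
have : (pdiv n %| gcdn n N`!)%N.
  by rewrite dvdn_gcd pdiv_dvd prime_dvd_fact// (leq_trans (pdiv_leq _))//; lia.
by rewrite (eqP cn) dvdn1; case: (pdiv n) pp => [|[]].
Qed.

(** The Euler product of zeta (1 + s), in logarithmic form. Dividing zeta by
    the Euler factors of the p <= N leaves the sum over the sieved integers,
    which lies between its first term 1 and 1 plus the tail of zeta beyond N. *)
Lemma cvg_log_euler_prod : log_euler_prod @ \oo --> ln (zeta1 s).
Proof.
have z0 : 0 < zeta1 s.
  by have := zeta1_ge s0; rewrite -(pmulr_rgt0 _ s0) => /(lt_le_trans ltr01).
have cz := cvg_zeta_sum s0.
have lo N : 1 <= zeta1 s * expR (- log_euler_prod N).
  rewrite -(cvg_lim _ (@cvg_sieve_sum N))//.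
  apply: limr_ge; first exact: cvgP (@cvg_sieve_sum N).
  by exists 1 => // x /=; exact: sieve_sum_ge.
have hi N : (0 < N)%N ->
    zeta1 s * expR (- log_euler_prod N) <= 1 + (zeta1 s - zeta_sum s N).
  move=> N0.
  have c1 : (fun x => 1 + (zeta_sum s x - zeta_sum s N)) @ \oo -->
      1 + (zeta1 s - zeta_sum s N).
    by apply: cvgD; [exact: cvg_cst|apply: cvgB => //; exact: cvg_cst].
  rewrite -(cvg_lim _ (@cvg_sieve_sum N))// -(cvg_lim _ c1)//.
  apply: ler_lim; [exact: cvgP (@cvg_sieve_sum N)|exact: cvgP c1|].
  by exists N => // x /= Nx; exact: sieve_sum_le.
have E N : ln (zeta1 s * expR (- log_euler_prod N)) =
    ln (zeta1 s) - log_euler_prod N.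
  by rewrite lnM ?posrE ?expR_gt0// expRK.
have d0 : (fun N => zeta1 s - zeta_sum s N) @ \oo --> 0.
  by rewrite -(subrr (zeta1 s)); apply: cvgB => //; exact: cvg_cst.
apply/cvgrPdist_le => eps eps0.
have /cvgrPdist_le/(_ _ eps0)[N1 _ N1h] := d0.
exists N1.+1 => // N /= NN.
have N0 : (0 < N)%N by lia.
have := N1h N (ltnW NN); rewrite sub0r normrN => /(le_trans (ler_norm _)) h1.
rewrite -E ger0_norm; last by apply: ln_ge0.
have P0 : 0 < zeta1 s * expR (- log_euler_prod N) by apply: lt_le_trans (lo N).
apply: le_trans (ln_le_subr1 P0) _.
by apply: le_trans h1; rewrite lerBlDl hi.
Qed.

End EulerProduct.

(** * The logarithmic series *)

Section LogSeries.
Local Open Scope classical_set_scope.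
Variable R : realType.
Implicit Types r x : R.

Definition log_sum K r : R := \sum_(0 <= k < K) r ^+ k.+1 / k.+1%:R.

Lemma is_derive_neglog_rem K x : x < 1 ->
  is_derive x 1 (fun y => neglog y - log_sum K y)
    ((1 - x)^-1 - \sum_(0 <= k < K) x ^+ k).
Proof.
move=> x1; elim: K => [|K IH].
  have -> : (fun y => neglog y - log_sum 0 y) = - (@ln R \o (fun y => 1 - y)).
    by apply/funext => y; rewrite /log_sum big_geq// subr0.
  rewrite big_geq// subr0.
  have H : is_derive (1 - x) 1 (@ln R) (1 - x)^-1 by apply: is_derive1_ln; lra.
  have H2 : is_derive x 1 (fun y : R => 1 - y) (- 1).
    have -> : (fun y : R => 1 - y) = (cst 1 - id) by apply/funext.
    by apply: is_derive_eq; rewrite sub0r.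
  have -> : (1 - x)^-1 = - ((1 - x)^-1 * - 1) by rewrite mulrN1 opprK.
  apply: is_deriveN; exact: is_derive1_comp.
have -> : (fun y => neglog y - log_sum K.+1 y) =
    (fun y => neglog y - log_sum K y) - (K.+1%:R^-1 *: (@id R) ^+ K.+1).
  apply/funext => y; rewrite /log_sum big_nat_recr//= opprD addrA; congr (_ - _).
  rewrite -[RHS]/(K.+1%:R^-1 * ((@id R) ^+ K.+1) y) mulrC; congr (_ * _).
  by elim: K.+1 => [|n IHn]; rewrite ?expr0// !exprS IHn.
rewrite big_nat_recr//= opprD addrA. apply: is_deriveB.
apply: is_derive_eq.
by rewrite /= /GRing.scale/= mulr1 mulrA mulVf ?mul1r ?pnatr_eq0.
Qed.

(** By the mean value theorem, since the remainder vanishes at 0 and has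
    derivative x ^ K/(1 - x). *)
Lemma neglog_series_bound K r : 0 < r < 1 ->
  `|neglog r - log_sum K r| <= r ^+ K / (1 - r).
Proof.
move=> /andP[r0 r1]; set f := fun y => neglog y - log_sum K y.
have df x : x < 1 -> is_derive x 1 f ((1 - x)^-1 - \sum_(0 <= k < K) x ^+ k).
  exact: is_derive_neglog_rem.
have [||c /andP[]] :=
  @MVT R f (fun x => (1 - x)^-1 - \sum_(0 <= k < K) x ^+ k) 0 r r0.
- by move=> x /andP[_ xr]; apply: df; rewrite bnd_simp in xr; lra.
- apply: derivable_within_continuous => x /andP[_ xr]; rewrite bnd_simp in xr.
  have /df [] : x < 1 by lra.
  by [].
rewrite !bnd_simp => c0 cr.
have -> : f 0 = 0.
  rewrite /f /neglog subr0 ln1 oppr0 sub0r /log_sum big1 ?oppr0// => k _.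
  by rewrite expr0n mul0r.
rewrite !subr0 -/(f r) => ->.
have -> : (1 - c)^-1 - \sum_(0 <= k < K) c ^+ k = c ^+ K / (1 - c).
  have c1 : 1 - c != 0 by rewrite gt_eqF//; lra.
  apply: (mulIf c1); rewrite mulrBl mulVf// mulfVK// big_mkord.
  have := subrX1 c K; rewrite mulrC -opprB => E.
  by rewrite -[1 - c]opprB mulrN -E; ring.
have cK : 0 <= c ^+ K by rewrite exprn_ge0// ltW.
have c1 : 0 < (1 - c)^-1 by rewrite invr_gt0; lra.
rewrite ger0_norm; last by rewrite !mulr_ge0// ltW.
rewrite -[leRHS]mulr1; apply: ler_pM; [by rewrite mulr_ge0// ltW|exact: ltW| |lra].
apply: ler_pM => //; first exact: ltW.
  by rewrite lerXn2r// ?nnegrE ltW.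
by rewrite lef_pV2 ?posrE; lra.
Qed.

Lemma cvg_log_sum r : 0 < r < 1 -> log_sum ^~ r @ \oo --> neglog r.
Proof.
move=> /[dup] r01 /andP[r0 r1]; apply/cvgrPdist_le => eps eps0.
have : (fun K => r ^+ K / (1 - r)) @ \oo --> 0.
  rewrite -(mul0r (1 - r)^-1); apply: cvgMl.
  by apply: cvg_expr; rewrite gtr0_norm.
move=> /cvgrPdist_le/(_ _ eps0); apply: filterS => K.
rewrite sub0r normrN => /(le_trans (ler_norm _)); apply: le_trans.
exact: neglog_series_bound.
Qed.

End LogSeries.

(** * Sums over primes cut at powers of e *)

Section Abelian.
Local Open Scope classical_set_scope.
Variable R : realType.
Implicit Types (p k m n K : nat) (s t u q : R).

(** Cutting the primes at these points groups them by their logarithm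
    rounded up, and turns ln ln into ln k, comparable to a harmonic sum. *)
Definition floor_exp k : nat := Num.truncn (expR k%:R : R).

Lemma leq_floor_exp p k : (0 < p)%N -> (p <= floor_exp k)%N = (ln p%:R <= k%:R :> R).
Proof.
move=> p0; rewrite truncn_ge_nat ?expR_ge0// -[k%:R in RHS]expRK.
by rewrite ler_ln ?posrE ?expR_gt0 ?ltr0n.
Qed.

Lemma floor_exp_gt0 k : (0 < floor_exp k)%N.
Proof. by rewrite leq_floor_exp// ln1. Qed.

Lemma floor_exp0 : floor_exp 0 = 1%N.
Proof. by rewrite /floor_exp expR0 truncn1. Qed.

Lemma leq_floor_expS k : (floor_exp k <= floor_exp k.+1)%N.
Proof. by apply: le_truncn; rewrite ler_expR ler_nat. Qed.

(** Rounding e ^ k down changes its logarithm k by at most 1, which the second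
    logarithm divides by k - 1. *)
Lemma lnln_floor_exp k : (3 <= k)%N ->
  `|ln (ln (floor_exp k)%:R) - ln k%:R| <= (k%:R - 1)^-1 :> R.
Proof.
move=> k3; set N := floor_exp k.
have k3R : 3 <= k%:R :> R by rewrite (ler_nat R 3).
have N0 : 0 < N%:R :> R by rewrite ltr0n floor_exp_gt0.
have hi : ln N%:R <= k%:R :> R by rewrite -leq_floor_exp// floor_exp_gt0.
have lo : k%:R - 1 <= ln N%:R :> R.
  have : expR k%:R <= N%:R * expR 1 :> R.
    have h1 : expR k%:R < N%:R + 1 :> R by rewrite natr1 truncnS_gt.
    have h2 := expR_ge1Dx (1 : R).
    have h3 : 1 <= N%:R :> R by rewrite ler1n floor_exp_gt0.
    nra.
  rewrite -{1}[N%:R]lnK ?posrE// -expRD ler_expR; lra.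
have l0 : 0 < ln N%:R :> R by lra.
have kl0 : 0 < k%:R / ln N%:R :> R by rewrite divr_gt0//; lra.
rewrite distrC -ln_div ?posrE//; last by lra.
rewrite ger0_norm; last by apply: ln_ge0; rewrite ler_pdivlMr// mul1r.
apply: le_trans (ln_le_subr1 kl0) _.
have -> : k%:R / ln N%:R - 1 = (k%:R - ln N%:R) / ln N%:R :> R.
  by field; rewrite gt_eqF.
rewrite -[leRHS]mul1r; apply: ler_pM; [lra|rewrite invr_ge0; lra|lra|].
by rewrite lef_pV2 ?posrE; lra.
Qed.

Lemma npow_bounds s p k : 0 < s -> (0 < p)%N -> k%:R <= ln (p%:R : R) <= k.+1%:R ->
  expR (- s) * npow s p <= expR (- s) ^+ k.+1 <= npow s p.
Proof.
move=> s0 p0 /andP[lo hi]; rewrite -expRM_natl mulrN /npow -expRD !ler_expR.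
have kE : k.+1%:R = k%:R + 1 :> R by rewrite natr1.
by rewrite kE in hi *; apply/andP; split; nra.
Qed.

(** The terms linear in u cancel. For u = 1/p and q = p ^ - s, this allows to
    replace the Euler factor at 1 + s by the one at 1 damped by p ^ - s. *)
Lemma neglog_scale u q : 0 <= u <= 2^-1 -> 0 < q <= 1 ->
  `|q * neglog u - neglog (q * u)| <= 2 * (1 - q) * u ^+ 2.
Proof.
move=> /andP[u0 u1] /andP[q0 q1].
have qu0 : 0 <= q * u by rewrite mulr_ge0// ltW.
have qu : q * u <= u by rewrite ler_piMl.
have a0 : 0 < 1 - u by lra.
have b0 : 0 < 1 - q * u by lra.
have ui : 1 <= (1 - u)^-1 <= 2.
  by rewrite invf_ge1// invf_ple ?posrE//; apply/andP; split; lra.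
have hU : neglog u - u <= 2 * u ^+ 2.
  have := @neglog_le _ u; rewrite -subr_gt0 => /(_ a0).
  have : u / (1 - u) = u + u ^+ 2 / (1 - u) by field; rewrite gt_eqF.
  have : u ^+ 2 / (1 - u) <= u ^+ 2 * 2.
    by apply: ler_wpM2l; [rewrite exprn_ge0|case/andP: ui].
  lra.
have hU0 : u <= neglog u by apply: neglog_ge; lra.
have E : neglog u - neglog (q * u) = ln ((1 - q * u) / (1 - u)).
  by rewrite ln_div ?posrE// /neglog opprK addrC.
have c0 : 0 < (1 - q * u) / (1 - u) by rewrite divr_gt0.
have H1 := ln_le_subr1 c0; have H2 := ln_ge_1subV c0.
rewrite -E in H1 H2; rewrite invf_div in H2.
have E1 : (1 - q * u) / (1 - u) - 1 = (1 - q) * u * (1 - u)^-1.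
  by field; rewrite gt_eqF.
have E2 : 1 - (1 - u) / (1 - q * u) = (1 - q) * u * (1 - q * u)^-1.
  by field; rewrite gt_eqF.
have qi : 1 <= (1 - q * u)^-1 by rewrite invf_ge1//; lra.
have p0 : 0 <= (1 - q) * u by rewrite mulr_ge0//; lra.
have L2 : (1 - q) * u <= neglog u - neglog (q * u).
  by apply: le_trans H2; rewrite E2 ler_peMr.
have L1 : neglog u - neglog (q * u) <= (1 - q) * u + 2 * (1 - q) * u ^+ 2.
  apply: le_trans H1 _; rewrite E1.
  have -> : (1 - q) * u * (1 - u)^-1 =
      (1 - q) * u + (1 - q) * u ^+ 2 * (1 - u)^-1.
    by field; rewrite gt_eqF.
  have -> : 2 * (1 - q) * u ^+ 2 = (1 - q) * u ^+ 2 * 2 by ring.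
  rewrite lerD2l ler_wpM2l//; last by case/andP: ui.
  by rewrite mulr_ge0 ?exprn_ge0//; lra.
have L3 : (1 - q) * (neglog u - u) <= (1 - q) * (2 * u ^+ 2).
  by apply: ler_wpM2l => //; lra.
have L4 : 0 <= (1 - q) * (neglog u - u) by apply: mulr_ge0; lra.
rewrite ler_norml; apply/andP; split; nra.
Qed.

Lemma npow_ge s p : 0 < s -> 1 - npow s p <= s * ln p%:R.
Proof. by move=> s0; have := expR_ge1Dx (- s * ln p%:R); rewrite /npow; lra. Qed.

(** Each prime costs at most 2 (1 - p ^ - s)/p^2 <= 2 s ln p/p^2, which is
    summable. *)
Lemma log_euler_prod_approx s N : 0 < s ->
  `|prime_sum (fun p => npow s p * neglog p%:R^-1) N - log_euler_prod s N| <=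
  4 * s.
Proof.
move=> s0; have [N2|N2] := ltnP N 2.
  by rewrite /log_euler_prod !prime_sum_lt2// subrr normr0; lra.
pose g k : R := ln k%:R / (k%:R * (k%:R - 1)).
have g0 k : (1 < k)%N -> 0 <= g k.
  by move=> k1; rewrite divr_ge0 ?ln_nat_ge0// mulr_ge0// subr_ge0 ler1n ltnW.
rewrite /log_euler_prod -prime_sumN -prime_sumD.
apply: (@le_trans _ _ (prime_sum (fun p => 2 * s * g p) N)).
  apply: le_trans (ler_norm_sum _ _ _) _.
  apply: le_prime_sum => p pp _; have p2 := prime_natr_ge2 R pp.
  have u0 : 0 < p%:R^-1 :> R by rewrite invr_gt0; lra.
  have u1 : p%:R^-1 <= 2^-1 :> R by rewrite lef_pV2 ?posrE; lra.
  rewrite /zterm [p%:R^-1 * _]mulrC.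
  have H : `|npow s p * neglog p%:R^-1 - neglog (npow s p * p%:R^-1)| <=
      2 * (1 - npow s p) * p%:R^-1 ^+ 2.
    by apply: neglog_scale; rewrite ?(ltW u0)// npow_gt0 npow_le1.
  apply: (le_trans H); rewrite -!mulrA ler_wpM2l//.
  apply: (@le_trans _ _ (s * ln p%:R * p%:R^-1 ^+ 2)).
    by rewrite ler_wpM2r ?exprn_ge0 ?npow_ge// ltW.
  rewrite -mulrA; apply: ler_wpM2l; first exact: ltW.
  rewrite /g; apply: ler_wpM2l; first exact: ln_nat_ge0.
  have pp1 : 0 < p%:R * (p%:R - 1) :> R by apply: mulr_gt0; lra.
  have p0 : 0 < p%:R :> R by lra.
  by rewrite exprVn lef_pV2 ?posrE ?exprn_gt0//; nra.
have -> : 4 * s = 2 * s * 2 by ring.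
rewrite prime_sumZ; apply: ler_wpM2l; first lra.
apply: le_trans (sum_ln_invMpred_le R (ltnW N2)).
have gE : prime_sum g N = prime_sum g N - prime_sum g 1.
  by rewrite [prime_sum g 1]prime_sum_lt2// subr0.
rewrite gE prime_sumB; last exact: ltnW.
by apply: (@prime_tail_le R g g 1 N) => //; exact: ltnW.
Qed.

End Abelian.

(** * The constant of Mertens's theorem *)

Section Identification.
Local Open Scope classical_set_scope.
Variable R : realType.
Implicit Types (p k m n K : nat) (s t : R).

(** Abel's limit theorem: as t tends to 0, the power series with partial sums
    D, taken at exp (- t^2), tends to the limit d of D; hence d = 0 when it is
    O(t). The parameter is t^2 because the errors to come contain s ln s,
    which is O(sqrt s) and not O(s). *)
Lemma abel_limit0 (D : nat -> R) d C : D 0%N = 0 -> D @ \oo --> d ->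
  (forall t, 0 < t <= 1 -> \forall K \near \oo,
    `|\sum_(0 <= k < K) (D k.+1 - D k) * expR (- t ^+ 2) ^+ k.+1| <= C * t) ->
  d = 0.
Proof.
move=> D0 Dd H; apply/eqP; rewrite -normr_le0; apply/ler_addgt0Pl => e e0.
rewrite addr0.
pose eps := e / 4; have eps0 : 0 < eps by rewrite divr_gt0.
have /cvgrPdist_le/(_ _ eps0)[m0 _ Dm] := Dd.
pose Q := \sum_(0 <= k < m0) `|D k.+1 - D k| * k.+1%:R.
have Q0 : 0 <= Q by apply: sumr_ge0 => k _; rewrite mulr_ge0.
have cq0 : 0 < `|C| + Q + 1 by rewrite ltr_wpDl// addr_ge0.
pose t := Num.min 1 (eps / (`|C| + Q + 1)).
have t0 : 0 < t by rewrite lt_min ltr01 divr_gt0.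
have t1 : t <= 1 by rewrite ge_min lexx.
have tQ : t * (`|C| + Q + 1) <= eps by rewrite -ler_pdivlMr// ge_min lexx orbT.
have t01 : 0 < t <= 1 by rewrite t0.
have [K1 _ HK] := H t t01.
have := HK (maxn K1 m0) (leq_maxl _ _).
rewrite (big_cat_nat _ (n := m0)) ?leq_maxr//=.
set K := maxn _ _; set r := expR _.
have r0 : 0 < r by exact: expR_gt0.
have r1 : r <= 1 by rewrite -expR0 ler_expR oppr_le0 exprn_ge0// ltW.
set S1 := \sum_(0 <= k < m0) _; set S2 := \sum_(m0 <= k < K) _ => S12.
have B2 : `|S2| <= 2 * eps * r ^+ m0.
  have -> : S2 = \sum_(m0 <= k < K) ((D k.+1 - d) - (D k - d)) * r ^+ k.+1.
    by apply: eq_bigr => k _; rewrite opprB addrA subrK.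
  apply: (@abel_bound R (fun k => D k - d) (fun k => r ^+ k)); first exact: leq_maxr.
    by move=> k mk; rewrite distrC; exact: Dm.
  by move=> k _; rewrite exprn_ge0/= ?exprS ?ler_piMl ?exprn_ge0// ltW.
have rm : r ^+ m0 <= 1 by rewrite exprn_ile1// ltW.
have B1 : `|D m0 - S1| <= t * Q.
  have -> : D m0 = \sum_(0 <= k < m0) (D k.+1 - D k).
    by rewrite telescope_sumr// D0 subr0.
  rewrite /S1 -sumrB; apply: le_trans (ler_norm_sum _ _ _) _.
  rewrite /Q mulr_sumr; apply: ler_sum => k _.
  rewrite -{1}[D k.+1 - D k]mulr1 -mulrBr normrM mulrCA ler_wpM2l//.
  have rk : r ^+ k.+1 <= 1 by rewrite exprn_ile1// ltW.
  rewrite ger0_norm ?subr_ge0//.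
  have -> : r ^+ k.+1 = expR (- (k.+1%:R * t ^+ 2)) by rewrite /r -expRM_natl mulrN.
  have h := expR_ge1Dx (- (k.+1%:R * t ^+ 2)).
  have : k.+1%:R * t ^+ 2 <= k.+1%:R * t.
    by rewrite ler_wpM2l// expr2 ler_piMl// ltW.
  rewrite [t * _]mulrC; lra.
have B0 := Dm m0 (leqnn m0).
have tC : C * t <= `|C| * t by rewrite ler_wpM2r ?ler_norm// ltW.
have C0 : 0 <= `|C| * t by rewrite mulr_ge0// ltW.
have -> : d = (d - D m0) + (D m0 - S1) + (S1 + S2) - S2 by ring.
apply: le_trans (ler_normB _ _) _.
have N1 := ler_normD ((d - D m0) + (D m0 - S1)) (S1 + S2).
have N2 := ler_normD (d - D m0) (D m0 - S1).
have B2' : `|S2| <= 2 * eps by apply: (le_trans B2); rewrite ler_piMr//; lra.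
have E : e = 4 * eps by rewrite /eps; field.
rewrite E; nra.
Qed.

Lemma zeta1_log_bounds s : 0 < s -> 0 <= ln (zeta1 s) + ln s <= s.
Proof.
move=> s0; have z1 := zeta1_ge s0; have z2 := zeta1_le s0.
have z0 : 0 < zeta1 s by have := lt_le_trans ltr01 z1; rewrite pmulr_rgt0.
rewrite -lnM ?posrE// mulrC ln_ge0//=.
have := @ln_le_subr1 _ (s * zeta1 s); rewrite mulr_gt0// => /(_ isT); lra.
Qed.

(** 1 - exp (- s) lies between s/(1 + s) and s. *)
Lemma neglog_expR_bounds s : 0 < s -> 0 <= neglog (expR (- s)) + ln s <= s.
Proof.
move=> s0; have h1 := expR_ge1Dx (- s); have h2 := expR_ge1Dx s.
have e0 := expR_gt0 (- s).
have e1 : expR (- s) < 1 by rewrite expR_lt1; lra.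
have d0 : 0 < 1 - expR (- s) by lra.
have -> : neglog (expR (- s)) + ln s = ln (s / (1 - expR (- s))).
  by rewrite ln_div ?posrE// /neglog addrC.
have q0 : 0 < s / (1 - expR (- s)) by rewrite divr_gt0.
apply/andP; split; first by apply: ln_ge0; rewrite ler_pdivlMr//; lra.
apply: le_trans (ln_le_subr1 q0) _; rewrite lerBlDr ler_pdivrMr//.
have E : expR s * expR (- s) = 1 by rewrite -expRD subrr expR0.
nra.
Qed.

(* The sum of the logarithms of the Euler factors at 1, and its difference at
   e ^ k with the k-th harmonic number. *)
Let W : nat -> R := prime_sum (fun p => neglog p%:R^-1).
Let D k : R := W (floor_exp R k) - series harmonic k.

Lemma cvg_floor_exp : floor_exp R @ \oo --> \oo.
Proof.
apply/cvgnyPge => A; exists A.+1 => // k /= Ak.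
have k0 : (0 < k)%N by lia.
rewrite (leq_trans (ltnW Ak))// leq_floor_exp//.
by have := @ln_le_subr1 R k%:R; rewrite ltr0n => /(_ k0); lra.
Qed.

(** At e ^ k, the double logarithm of the prime sum and the logarithm of the
    harmonic sum are both ln k up to o(1), and cancel. *)
Lemma cvg_prime_harmonic_diff :
  D @ \oo --> limn (mertens_diff R) - euler_gamma R.
Proof.
have fe := cvg_floor_exp.
have c1 := cvg_comp _ _ fe (mertens2 R).1.
have c3 := (euler_gamma_rate R).1.
have c2 : (fun k => ln (ln (floor_exp R k)%:R) - ln k%:R : R) @ \oo --> (0 : R).
  apply/cvgrPdist_le => e e0.
  have := @cvg_invn R => /cvgrPdist_le/(_ _ e0)[N _ HN].
  exists (N + 3)%N => // -[|k] /= Nk; first by lia.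
  rewrite sub0r normrN; apply: (le_trans (lnln_floor_exp _ _)); first by lia.
  have h : `|0 - k%:R^-1| <= e by apply: HN; rewrite /=; lia.
  rewrite sub0r normrN in h; rewrite -natr1 addrK.
  exact: le_trans (ler_norm _) h.
have -> : D = ((mertens_diff R \o floor_exp R) \+
    (fun k => ln (ln (floor_exp R k)%:R) - ln k%:R)) \-
    (fun k => series harmonic k - ln k%:R).
  by apply/funext => k; rewrite /= /mertens_diff /D -/W; ring.
rewrite -[limn _]addr0; apply: cvgB => //; exact: cvgD.
Qed.

(** A prime p with k < ln p <= k + 1 has p ^ - s between exp (- s (k + 1)) and
    exp s times this. *)
Lemma laplace_compare s K : 0 < s ->
  expR (- s) * prime_sum (fun p => npow s p * neglog p%:R^-1) (floor_exp R K)
    <= \sum_(0 <= k < K)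
      (W (floor_exp R k.+1) - W (floor_exp R k)) * expR (- s) ^+ k.+1
    <= prime_sum (fun p => npow s p * neglog p%:R^-1) (floor_exp R K).
Proof.
move=> s0.
set P := prime_sum (fun p => npow s p * neglog p%:R^-1) (floor_exp R K).
pose Pf n := prime_sum (fun p => npow s p * neglog p%:R^-1 : R) n.
have PE : P = \sum_(0 <= k < K) (Pf (floor_exp R k.+1) - Pf (floor_exp R k)).
  by rewrite (telescope_sumr (fun k => Pf (floor_exp R k)))// floor_exp0
    {2}/Pf prime_sum_lt2// subr0.
have step k : expR (- s) * (Pf (floor_exp R k.+1) - Pf (floor_exp R k)) <=
    (W (floor_exp R k.+1) - W (floor_exp R k)) * expR (- s) ^+ k.+1 <=
    Pf (floor_exp R k.+1) - Pf (floor_exp R k).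
  rewrite /Pf /W !prime_sumB ?leq_floor_expS// mulr_sumr mulr_suml.
  have B p : prime p -> (floor_exp R k < p < (floor_exp R k.+1).+1)%N ->
    0 <= neglog p%:R^-1 :> R /\
    expR (- s) * npow s p <= expR (- s) ^+ k.+1 <= npow s p.
    move=> pp; rewrite ltnS ltnNge !leq_floor_exp ?prime_gt0// -ltNge => /andP[h1 h2].
    split; last by apply: npow_bounds; rewrite ?prime_gt0// ltW.
    have /andP[h _] := neglogV_prime_bounds R pp.
    have : 0 <= p%:R^-1 :> R by rewrite invr_ge0.
    lra.
  apply/andP; split; rewrite big_nat_cond [leRHS]big_nat_cond;
    apply: ler_sum => p /andP[pk /= pp]; have [n0 /andP[b1 b2]] := B p pp pk.
    by rewrite mulrA mulrC ler_wpM2l.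
  by rewrite mulrC ler_wpM2r.
rewrite PE mulr_sumr; apply/andP; split;
  by apply: ler_sum => k _; have /andP[] := step k.
Qed.

(** Let s = t^2. Damped by exp (- s k), the sum W becomes ln zeta (1 + s), up to
    O(s |ln s|), by the Euler product; the harmonic sum becomes the logarithmic
    series - ln (1 - exp (- s)). Both are - ln s + O(s), since zeta (1 + s) and
    1/(1 - exp (- s)) are both 1/s + O(1). *)
Lemma laplace_diff_small t : 0 < t <= 1 -> \forall K \near \oo,
  `|\sum_(0 <= k < K) (D k.+1 - D k) * expR (- t ^+ 2) ^+ k.+1| <= 15 * t.
Proof.
move=> /andP[t0 t1]; set s := t ^+ 2.
have s0 : 0 < s by rewrite exprn_gt0.
have st : s <= t by rewrite /s expr2 ler_piMl// ltW.
have fe := cvg_floor_exp.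
have r0 := expR_gt0 (- s).
have r1 : expR (- s) < 1 by rewrite expR_lt1; lra.
have r01 : 0 < expR (- s) < 1 by rewrite r0.
have /cvgrPdist_le/(_ _ s0) H1 := cvg_comp _ _ fe (cvg_log_euler_prod s0).
have /cvgrPdist_le/(_ _ s0) H2 := cvg_log_sum r01.
near=> K.
have h1 : `|ln (zeta1 s) - log_euler_prod s (floor_exp R K)| <= s.
  by near: K; exact: H1.
have h2 : `|neglog (expR (- s)) - log_sum K (expR (- s))| <= s.
  by near: K; exact: H2.
have h3 := log_euler_prod_approx (floor_exp R K) s0.
have /andP[h4 h5] := laplace_compare K s0.
have /andP[h6 h7] := zeta1_log_bounds s0.
have /andP[h8 h9] := neglog_expR_bounds s0.
have h10 := expR_ge1Dx (- s).
have h11 : - (s * ln s) <= 2 * t.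
  have := @ln_le_subr1 R t^-1; rewrite invr_gt0 => /(_ t0).
  rewrite lnV ?posrE// => l1.
  have ti : t * t^-1 = 1 by rewrite divff// gt_eqF.
  rewrite /s lnXn// mulr2n expr2; nra.
have -> : \sum_(0 <= k < K) (D k.+1 - D k) * expR (- s) ^+ k.+1 =
  \sum_(0 <= k < K) (W (floor_exp R k.+1) - W (floor_exp R k)) * expR (- s) ^+ k.+1
  - log_sum K (expR (- s)).
  rewrite /log_sum -sumrB; apply: eq_bigr => k _.
  by rewrite /D seriesSr/=; ring.
set V := \sum_(0 <= k < K) _ in h4 h5 *.
set P := prime_sum _ _ in h3 h4 h5.
set G := log_euler_prod _ _ in h1 h3.
set S := log_sum _ _ in h2 *.
have P0 : 0 <= P.
  apply: prime_sum_ge0 => p pp; apply: mulr_ge0; first exact/ltW/npow_gt0.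
  have /andP[h _] := neglogV_prime_bounds R pp.
  by apply: le_trans (_ : p%:R^-1 <= _); rewrite ?invr_ge0//; lra.
move: h1 h2 h3; rewrite !ler_norml => /andP[a1 a2] /andP[a3 a4] /andP[a5 a6].
have Pb : P <= - ln s + 6 * s by lra.
have sP : s * P <= 2 * t + 6 * s by nra.
have VP : P - V <= s * P by nra.
by apply/andP; split; lra.
Unshelve. all: end_near. Qed.

(** Mertens's third theorem, with the constant identified. *)
Lemma mertens_constant : limn (mertens_diff R) = euler_gamma R.
Proof.
apply/eqP; rewrite -subr_eq0; apply/eqP.
apply: (@abel_limit0 D _ 15);
  [|exact: cvg_prime_harmonic_diff|exact: laplace_diff_small].
rewrite /D floor_exp0 /W prime_sum_lt2// sub0r.
by rewrite /series/= big_geq// oppr0.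
Qed.

End Identification.

(** * The sum of 1/(p - 1) *)

Section InvPred.
Local Open Scope classical_set_scope.
Variable R : realType.
Implicit Types (p k m n N X : nat).

(** The general term of the sum in F. *)
Definition invpred_excess p : R := ln (1 - p%:R^-1) + (p%:R - 1)^-1.

Lemma invpred_excess_bounds p : prime p ->
  0 <= invpred_excess p <= (p%:R * (p%:R - 1))^-1.
Proof.
move=> pp; have p2 := prime_natr_ge2 R pp.
have u1 : p%:R^-1 < 1 :> R by rewrite invf_lt1; lra.
have h1 := neglog_ge u1; have h2 := neglog_le u1.
have E2 : p%:R^-1 / (1 - p%:R^-1) = (p%:R - 1)^-1 :> R.
  by field; rewrite !gt_eqF//; lra.
have E : invpred_excess p = (p%:R - 1)^-1 - neglog p%:R^-1.
  by rewrite /invpred_excess /neglog opprK addrC.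
have E1 : (p%:R * (p%:R - 1))^-1 = (p%:R - 1)^-1 - p%:R^-1 :> R.
  by field; rewrite !gt_eqF//; lra.
rewrite E2 in h2; rewrite E E1 subr_ge0 h2 /=.
by rewrite lerB.
Qed.

(** 1/(p-1) is the sum of the general term of F and of the logarithm of the
    Euler factor of p at 1: the former sums to F - gamma with an error O(1/N),
    the latter to ln ln N + gamma by Mertens's theorem. *)
Lemma sum_invpred N : (2 <= N)%N ->
  `|prime_sum (fun p => (p%:R - 1)^-1) N - (ln (ln N%:R) + F R)| <= 18 / ln N%:R.
Proof.
move=> N2.
have [cv rate] : cvgn (prime_sum invpred_excess) /\ forall m, (1 <= m)%N ->
    `|prime_sum invpred_excess m - limn (prime_sum invpred_excess)| <= m%:R^-1.
  apply: (@cauchy_rate R _ (fun m => m%:R^-1)); first exact: cvg_invn.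
  move=> m n m0 mn; rewrite prime_sumB// ger0_norm; last first.
    by apply: sumr_ge0 => p /invpred_excess_bounds/andP[].
  apply: le_trans (sum_invMpred_le R m0 mn); apply: prime_tail_le => //.
    by move=> k mk; rewrite invr_ge0 mulr_ge0// subr_ge0 ler1n; lia.
  by move=> p /invpred_excess_bounds/andP[].
have FE : F R = euler_gamma R + limn (prime_sum invpred_excess).
  rewrite /F; congr (_ + _); apply: cvg_lim => //.
  by rewrite -cvg_shiftS; exact: cv.
have E : prime_sum (fun p => (p%:R - 1)^-1) N =
    prime_sum invpred_excess N + prime_sum (fun p => neglog p%:R^-1) N :> R.
  rewrite -prime_sumD; apply: eq_prime_sum => p _ _.
  by rewrite /invpred_excess /neglog addrAC subrr add0r.
have h1 := rate N (ltnW N2).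
have h2 := (mertens2 R).2 N N2; rewrite mertens_constant in h2.
rewrite E FE.
have -> : prime_sum invpred_excess N + prime_sum (fun p => neglog p%:R^-1) N -
   (ln (ln N%:R) + (euler_gamma R + limn (prime_sum invpred_excess))) =
   (prime_sum invpred_excess N - limn (prime_sum invpred_excess)) +
   (mertens_diff R N - euler_gamma R) by rewrite /mertens_diff; ring.
apply: le_trans (ler_normD _ _) _.
have h3 := invn_le_invln R N2.
set a := `|_ - limn _| in h1 *; set b := `|_| in h2 *.
by apply: le_trans (lerD (le_trans h1 h3) h2) _; lra.
Qed.

End InvPred.

(** * The sum of B *)

Section SumOfB.
Variable R : realType.
Implicit Types (p k m n N X : nat).

Lemma sum_primes (f : nat -> nat) n X : (0 < n)%N -> (n <= X)%N ->
  (\sum_(p <- primes n) f p =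
   \sum_(0 <= p < X.+1 | prime p) (p %| n) * f p)%N.
Proof.
move=> n0 nX; rewrite [RHS](bigID (fun p => p %| n)%N)/=.
rewrite [X in (_ + X)%N]big1; last first.
  by move=> p /andP[_ /negbTE->].
rewrite addn0.
transitivity (\sum_(p <- [seq p <- index_iota 0 X.+1 | prime p && (p %| n)])
  f p)%N; last first.
  by rewrite big_filter; apply: eq_bigr => p /andP[_ ->]; rewrite mul1n.
apply: perm_big; apply: uniq_perm.
- exact: primes_uniq.
- by rewrite filter_uniq// iota_uniq.
move=> p; rewrite mem_primes mem_filter n0 mem_index_iota/=.
case: (prime p) => //=; case pn: (p %| n)%N => //=.
by have := dvdn_leq n0 pn; lia.
Qed.

(** Exchanging summations, A contributes p times the exponent of p in X! and
    A* contributes p times the number floor (X/p) of multiples of p, that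
    is, p times the first term of Legendre's formula. *)
Lemma sum_B X :
  \sum_(1 <= n < X.+1) (B n)%:~R =
  prime_sum (fun p => p%:R * (logn_fact2 p X)%:R) X :> R.
Proof.
have EA : (\sum_(1 <= n < X.+1) A n =
    \sum_(0 <= p < X.+1 | prime p) logn p X`! * p)%N.
  transitivity (\sum_(1 <= n < X.+1) \sum_(0 <= p < X.+1 | prime p) logn p n * p)%N.
    rewrite !big_nat; apply: eq_bigr => n /andP[n0 nX].
    rewrite /A (@sum_primes (fun p => logn p n * p)%N n X)//.
    apply: eq_bigr => p pp; case pn: (p %| n)%N; first by rewrite mul1n.
    by rewrite lognE pp n0 pn.
  rewrite exchange_big/=; apply: eq_bigr => p pp; rewrite -big_distrl/=.
  congr (_ * _)%N; elim: X => [|X IH]; first by rewrite big_geq// fact0 logn1.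
  by rewrite big_nat_recr//= IH factS lognM// ?fact_gt0// addnC.
have ES : (\sum_(1 <= n < X.+1) Astar n =
    \sum_(0 <= p < X.+1 | prime p) X %/ p * p)%N.
  transitivity (\sum_(1 <= n < X.+1) \sum_(0 <= p < X.+1 | prime p) (p %| n) * p)%N.
    rewrite !big_nat; apply: eq_bigr => n /andP[n0 nX].
    by rewrite /Astar (@sum_primes id n X).
  rewrite exchange_big/=; apply: eq_bigr => p pp; rewrite -big_distrl/=.
  congr (_ * _)%N; elim: X {EA} => [|X IH]; first by rewrite big_geq// div0n.
  by rewrite big_nat_recr//= IH divnS ?prime_gt0// addnC.
transitivity ((\sum_(1 <= n < X.+1) A n)%:R - (\sum_(1 <= n < X.+1) Astar n)%:R : R).
  rewrite !natr_sum -sumrB; apply: eq_bigr => n _.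
  by rewrite /B intrB.
rewrite EA ES !natr_sum -sumrB; apply: eq_bigr => p pp.
by rewrite logn_factE// !natrM -mulrBl natrD addrAC subrr add0r mulrC.
Qed.

Lemma logn_fact2_eq0 p X : (X < p * p)%N -> logn_fact2 p X = 0%N.
Proof.
move=> Xp; rewrite /logn_fact2 big_nat big1// => k /andP[k2 _].
apply: divn_small; apply: (leq_trans Xp); rewrite mulnn.
by apply: leq_pexp2l => //; case: p Xp => //; rewrite mul0n.
Qed.

(** From ln (y/p) <= 2 (sqrt (y/p) - 1) follows ln y <= 4 sqrt (y/p) ln p. *)
Lemma ln_ratio_sqr (p y : R) : 2 <= p -> p <= y ->
  p * ln y ^+ 2 <= 16 * y * ln p ^+ 2.
Proof.
move=> p2 py; set q := Num.sqrt (y / p).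
have p0 : 0 < p by lra.
have y0 : 0 < y by lra.
have q2 : q ^+ 2 = y / p by rewrite sqr_sqrtr// ltW// divr_gt0.
have q1 : 1 <= q.
  rewrite -[leLHS]sqrtr1 /q ler_sqrt; last by apply: divr_ge0; exact: ltW.
  by rewrite ler_pdivlMr// mul1r.
have a0 : 2^-1 <= ln p by apply: le_trans (ln2_ge R) _; apply: ler_ln_gt0.
have b0 : 0 <= ln y by apply: ln_ge0; lra.
have lq : ln y - ln p <= 2 * (q - 1).
  rewrite -ln_div ?posrE// -q2 lnXn; last exact: lt_le_trans ltr01 q1.
  by have := @ln_le_subr1 R q; rewrite (lt_le_trans ltr01 q1) => /(_ isT); lra.
have bq : ln y <= 4 * q * ln p by nra.
have b2 : ln y ^+ 2 <= (4 * q * ln p) ^+ 2 by rewrite lerXn2r// nnegrE; lra.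
have -> : 16 * y * ln p ^+ 2 = p * (4 * q * ln p) ^+ 2.
  by rewrite !exprMn q2; field; rewrite gt_eqF.
by rewrite ler_wpM2l// ltW.
Qed.

(** The number K of powers of p up to X is at most 2 ln y/ln p, where
    y = N + 1, so that p K is at most 2 p ln y/ln p = 2 p (ln y)^2/(ln p ln y),
    and the previous lemma applies. Estimating the error by a multiple of ln p
    is what makes Chebyshev's theta sufficient to sum it. *)
Lemma trunc_log_error p N X : prime p -> (p <= N)%N -> (p <= X)%N ->
  (X <= N.+1 ^ 2)%N ->
  p%:R * (trunc_log p X).+1%:R <= 64 * N.+1%:R / ln N.+1%:R * ln p%:R :> R.
Proof.
move=> pp pN pX XN; set K := trunc_log p X; set y : R := N.+1%:R.
have p2 := prime_natr_ge2 R pp.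
have py : p%:R <= y by rewrite ler_nat leqW.
have X0 : (0 < X)%N by apply: leq_trans pX; exact: prime_gt0.
have K1 : (0 < K)%N by rewrite trunc_log_gt0 prime_gt1//; have := prime_gt0 pp; lia.
have a0 : 2^-1 <= ln p%:R :> R by apply: ln_nat_ge; exact: prime_gt1.
have b0 : ln p%:R <= ln y by apply: ler_ln_gt0 => //; lra.
have Ka : K%:R * ln p%:R <= 2 * ln y.
  rewrite mulr_natl -lnXn; last by lra.
  have -> : 2 * ln y = ln (y ^+ 2) by rewrite lnXn ?mulr_natl// ltr0n.
  rewrite -!natrX; apply: ler_ln_gt0; first by rewrite ltr0n expn_gt0 prime_gt0.
  by rewrite ler_nat; apply: leq_trans XN; apply: trunc_logP => //; exact: prime_gt1.
have H := ln_ratio_sqr p2 py.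
have K2 : K.+1%:R <= 2 * K%:R :> R by rewrite -natrM ler_nat; lia.
have b1 : 0 < ln y by lra.
rewrite mulrAC ler_pdivlMr//.
set a := ln p%:R in a0 b0 Ka H *; set b := ln y in b0 b1 Ka H *.
have a1 : 0 < a by lra.
rewrite -(ler_pM2r a1).
have h1 : p%:R * K.+1%:R * b * a <= p%:R * b * (2 * (2 * b)).
  have -> : p%:R * K.+1%:R * b * a = p%:R * b * (K.+1%:R * a) by ring.
  apply: ler_wpM2l; first by apply: mulr_ge0; lra.
  by apply: (@le_trans _ _ (2 * K%:R * a)); [apply: ler_wpM2r; lra|lra].
apply: le_trans h1 _.
have -> : p%:R * b * (2 * (2 * b)) = 4 * (p%:R * b ^+ 2) by ring.
have -> : 64 * y * a * a = 4 * (16 * y * a ^+ 2) by ring.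
by apply: ler_wpM2l.
Qed.

(** Only the primes p <= N contribute. The errors of the previous lemma add up
    to a multiple of N theta N/ln N = O(N^2/ln N). *)
Lemma sum_B_approx N X : (1 < N)%N -> (N ^ 2 <= X)%N -> (X < N.+1 ^ 2)%N ->
  `|\sum_(1 <= n < X.+1) (B n)%:~R - X%:R * prime_sum (fun p => (p%:R - 1)^-1) N|
  <= 256 * N.+1%:R ^+ 2 / ln N.+1%:R :> R.
Proof.
move=> N1 NX XN.
have NX' : (N <= X)%N by apply: leq_trans NX; rewrite -mulnn leq_pmulr//; lia.
have lN : 0 < ln N.+1%:R :> R by have := @ln_nat_ge R N.+1 (leqW N1); lra.
rewrite sum_B (@prime_sum_widen _ _ N X) //; last first.
  move=> p pp Np; rewrite logn_fact2_eq0 ?mulr0//.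
  by apply: leq_trans XN _; rewrite -mulnn; apply: leq_mul.
rewrite -prime_sumZ -prime_sumN -prime_sumD.
apply: le_trans (ler_norm_sum _ _ _) _.
apply: (@le_trans _ _ (prime_sum
    (fun p => 64 * N.+1%:R / ln N.+1%:R * ln p%:R) N)).
  apply: le_prime_sum => p pp pN; have p2 := prime_natr_ge2 R pp.
  have pX := leq_trans pN NX'.
  have X0 : (0 < X)%N by apply: leq_trans pX; exact: prime_gt0.
  have hi := logn_fact2_le R X pp; have lo := @logn_fact2_ge R _ _ pp X0.
  have E : X%:R / (p%:R - 1) = p%:R * (X%:R / (p%:R * (p%:R - 1))) :> R.
    by field; rewrite !gt_eqF//; lra.
  rewrite E -mulrBr normrM ger0_norm//.
  apply: le_trans (trunc_log_error pp pN pX (ltnW XN)).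
  apply: ler_wpM2l => //; rewrite ler_norml; apply/andP; split.
    by rewrite lerBrDl.
  by apply: (@le_trans _ _ 0) => //; rewrite subr_le0.
rewrite prime_sumZ -/(theta R N).
apply: (@le_trans _ _ (64 * N.+1%:R / ln N.+1%:R * (4 * N.+1%:R))).
  apply: ler_wpM2l; first by rewrite divr_ge0 ?mulr_ge0// ltW.
  by apply: le_trans (theta_le R N) _; rewrite ler_wpM2l// ler_nat.
rewrite le_eqVlt; apply/orP; left; apply/eqP; field.
by rewrite gt_eqF.
Qed.

End SumOfB.

(** * Asymptotics for real x *)

Section Final.
Variable R : realType.

Lemma eqaddO_of_bound (f g h : R -> R) (C x0 : R) :
  (forall x, x0 <= x -> `|f x - g x| <= C * `|h x|) -> f = g +O_ (+oo%R) h.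
Proof.
move=> H; apply/eqaddOP; near=> k; near=> x.
apply: (@le_trans _ _ (C * `|h x|)).
  by apply: H; near: x; apply: nbhs_pinfty_ge; exact: num_real.
by apply: ler_wpM2r.
Unshelve. all: end_near. Qed.

Lemma ln_le_sqrt (x : R) : 0 < x -> ln x <= 2 * Num.sqrt x.
Proof.
move=> x0; have s0 : 0 < Num.sqrt x by rewrite sqrtr_gt0.
rewrite -[X in ln X](sqr_sqrtr (ltW x0)) lnXn//.
by have := ln_le_subr1 s0; lra.
Qed.

(** The constant collects 2048 for the integer parts in sum_B, 72 for Mertens's
    theorem, 4 for replacing ln ln N by ln ln (sqrt x), and 4 + |F| for
    replacing X by x in the main term. *)
Lemma sum_B_asymp (x : R) : 100 <= x ->
  `|\sum_(1 <= n < (Num.truncn x).+1) (B n)%:~R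
    - (x * ln (ln (Num.sqrt x)) + F R * x)| <= (2128 + `|F R|) * `|x / ln x|.
Proof.
move=> x100; have x0 : 0 < x by lra.
set y := Num.sqrt x; have yE : y ^+ 2 = x by rewrite sqr_sqrtr// ltW.
have y10 : 10 <= y.
  have -> : (10 : R) = Num.sqrt (10 ^+ 2) by rewrite sqrtr_sqr ger0_norm.
  by rewrite ler_sqrt; lra.
have y0 : 0 < y by lra.
set N := Num.truncn y; set X := Num.truncn x.
have /andP[Ny yN] : N%:R <= y < N.+1%:R by apply: truncn_itv; exact: ltW.
have /andP[Xx xX] : X%:R <= x < X.+1%:R by apply: truncn_itv; exact: ltW.
have N10 : (10 <= N)%N by rewrite truncn_ge_nat; lra.
have NX : (N ^ 2 <= X)%N.
  rewrite truncn_ge_nat; last exact: ltW.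
  by rewrite natrX -yE lerXn2r// nnegrE ?ler0n ?(ltW y0).
have XN : (X < N.+1 ^ 2)%N.
  rewrite truncn_lt_nat; last exact: ltW.
  by rewrite natrX -yE ltrXn2r// ?nnegrE ?ler0n ?(ltW y0).
set L := ln x.
have LE : L = 2 * ln y by rewrite /L -yE lnXn// mulr_natl.
have Nr : N.+1%:R = N%:R + 1 :> R by rewrite natr1.
have Xr : X.+1%:R = X%:R + 1 :> R by rewrite natr1.
rewrite Nr in yN; rewrite Xr in xX.
have N10R : 10 <= N%:R :> R by rewrite (ler_nat R 10).
have N0 : 0 < N%:R :> R by lra.
have lnN : ln y <= 2 * ln N%:R :> R.
  have -> : 2 * ln N%:R = ln (N%:R ^+ 2) :> R by rewrite lnXn// mulr_natl.
  by apply: ler_ln_gt0 => //; nra.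
have lnNy : ln N%:R <= ln y :> R by apply: ler_ln_gt0.
have lnN1 : 1 <= ln N%:R :> R.
  have : ln (2 ^+ 2) <= ln N%:R :> R by apply: ler_ln_gt0; lra.
  by rewrite lnXn// mulr2n; have := ln2_ge R; lra.
have L0 : 0 < L by lra.
have Li : 0 < L^-1 by rewrite invr_gt0.
have xL : 0 < x / L by rewrite divr_gt0.
rewrite -/L (gtr0_norm xL).
have E1 := @sum_B_approx R N X (leq_trans (isT : (1 < 10)%N) N10) NX XN.
have E2 := @sum_invpred R N (leq_trans (isT : (1 < 10)%N) N10).
set S := \sum_(_ <= n < _) _ in E1 *; set P := prime_sum _ _ in E1 E2.
have E1' : `|S - X%:R * P| <= 2048 * (x / L).
  apply: (le_trans E1); rewrite ler_pdivrMr; last first.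
    apply: lt_le_trans (_ : ln N%:R <= _); first lra.
    by apply: ler_ln_gt0 => //; rewrite ler_nat.
  have l1 : L <= 2 * ln N.+1%:R.
    by rewrite LE ler_wpM2l//; apply: ler_ln_gt0 => //; rewrite Nr ltW.
  have y2 : N.+1%:R ^+ 2 <= 4 * x by rewrite Nr -yE; nra.
  apply: (@le_trans _ _ (256 * (4 * x))); first by rewrite ler_wpM2l.
  have : x / L * L = x by rewrite divfK// gt_eqF.
  nra.
have E2' : X%:R * `|P - (ln (ln N%:R) + F R)| <= 72 * (x / L).
  apply: (@le_trans _ _ (x * (72 / L))); last by rewrite mulrCA.
  apply: ler_pM => //; apply: (le_trans E2).
  by rewrite ler_pdivrMr ?(lt_le_trans ltr01)// mulrAC ler_pdivlMr//; lra.
have E3 : X%:R * `|ln (ln N%:R) - ln (ln y)| <= 4 * (x / L).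
  apply: (@le_trans _ _ (x * (4 / L))); last by rewrite mulrCA.
  have lN0 : 0 < ln N%:R :> R by lra.
  have ly0 : 0 < ln y by lra.
  apply: ler_pM => //; rewrite distrC -ln_div ?posrE// ger0_norm; last first.
    by apply: ln_ge0; rewrite ler_pdivlMr// mul1r.
  apply: le_trans (ln_le_subr1 _) _; first by rewrite divr_gt0.
  have d1 : ln y - ln N%:R <= 1.
    rewrite -ln_div ?posrE//; apply: le_trans (ln_le_subr1 _) _.
      by rewrite divr_gt0.
    by rewrite lerBlDr ler_pdivrMr//; lra.
  have -> : ln y / ln N%:R - 1 = (ln y - ln N%:R) / ln N%:R.
    by field; rewrite gt_eqF.
  rewrite ler_pdivrMr// mulrAC ler_pdivlMr//.
  have : (ln y - ln N%:R) * L <= 1 * L by apply: ler_wpM2r => //; lra.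
  lra.
have LL : L <= 4 * (x / L).
  rewrite mulrA ler_pdivlMr//; have := ln_le_sqrt x0; rewrite -/L -/y => h.
  rewrite -yE; nra.
have ll0 : 0 <= ln (ln y) by apply: ln_ge0; lra.
have ll1 : ln (ln y) <= L.
  by have := @ln_le_subr1 R (ln y); rewrite (_ : 0 < ln y); [move=> /(_ isT)|]; lra.
have E4 : (x - X%:R) * `|ln (ln y) + F R| <= 4 * (x / L) + `|F R| * (x / L).
  apply: (@le_trans _ _ (1 * `|ln (ln y) + F R|)).
    by apply: ler_wpM2r => //; lra.
  rewrite mul1r; apply: le_trans (ler_normD _ _) _; rewrite (ger0_norm ll0).
  apply: lerD; first exact: le_trans LL.
  rewrite ler_peMr// ler_pdivlMr// mul1r /L.
  by apply: le_trans (ln_le_subr1 x0) _; lra.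
have -> : S - (x * ln (ln y) + F R * x) =
  (S - X%:R * P) + X%:R * (P - (ln (ln N%:R) + F R))
  + X%:R * (ln (ln N%:R) - ln (ln y)) - (x - X%:R) * (ln (ln y) + F R) by ring.
apply: le_trans (ler_normB _ _) _.
have h1 := ler_normD ((S - X%:R * P) + X%:R * (P - (ln (ln N%:R) + F R)))
  (X%:R * (ln (ln N%:R) - ln (ln y))).
have h2 := ler_normD (S - X%:R * P) (X%:R * (P - (ln (ln N%:R) + F R))).
have xX0 : 0 <= x - X%:R by lra.
rewrite !normrM (ger0_norm xX0) (ger0_norm (ler0n R X)) in h1 h2 *.
set T := x / L in E1' E2' E3 E4 *.
lra.
Qed.

End Final.

Theorem theorem7 (R : realType) :
  (fun x : R => \sum_(1 <= n < (Num.truncn x).+1) (B n)%:~R) =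
  (fun x : R => x * ln (ln (Num.sqrt x)) + F R * x)
    +O_ (+oo%R) (fun x : R => x / ln x).
Proof. exact: eqaddO_of_bound (@sum_B_asymp R). Qed.
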